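(* Let $k$ be a field, $G$ a finite group and $\mathfrak{h}$ a finite dimensional Leibniz algebra over $k$ with basis $\{e_1,\dots,e_n\}$. Then there exists a bijection between the set of all actions as automorphisms of $G$ on $\mathfrak{h}$ and the set of all bialgebra homomorphisms $\mathcal{A}(\mathfrak{h})\to k[G]^*$. The bijection is such that the group homomorphism $\varphi_\theta:G\to\mathrm{Aut}_{\mathrm{Lbz}}(\mathfrak{h})$ associated to a bialgebra homomorphism $\theta:\mathcal{A}(\mathfrak{h})\to k[G]^*$ is given by $$\varphi_\theta(g)(e_i)=\sum_{s=1}^n\langle\theta(x_{si}),g\rangle\,e_s$$ for all $g\in G$ and $i=1,\dots,n$.
   Context: All vector spaces, algebras and tensor products are over an arbitrary field $k$; algebras are unital and algebra homomorphisms preserve units. A Leibniz algebra is a vector space $\mathfrak{h}$ with a bilinear map $[-,-]$ satisfying $[x,[y,z]] = [[x,y],z]-[[x,z],y]$ for all $x,y,z$; homomorphisms are bracket-preserving linear maps, and $\mathrm{Aut}_{\mathrm{Lbz}}(\mathfrak{h})$ is the group of Leibniz algebra automorphisms of $\mathfrak{h}$. An action as automorphisms of a group $G$ on $\mathfrak{h}$ is a group homomorphism $\varphi:G\to\mathrm{Aut}_{\mathrm{Lbz}}(\mathfrak{h})$. $k[G]^*$ is the dual (commutative) bialgebra of the group algebra $k[G]$ of the finite group $G$, and $\langle-,-\rangle$ is the evaluation pairing between $k[G]^*$ and $k[G]$. Universal bialgebra $\mathcal{A}(\mathfrak{h})$: for the basis $\{e_1,\dots,e_n\}$ of $\mathfrak{h}$,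 with structure constants $[e_i,e_j]=\sum_{s=1}^n\tau_{i,j}^s e_s$, $\mathcal{A}(\mathfrak{h}):=k[X_{ij}\mid i,j=1,\dots,n]/J$, where $J$ is the ideal generated by the polynomials $$\sum_{u=1}^n\tau_{i,j}^u X_{au}-\sum_{s,t=1}^n\tau_{s,t}^a X_{si}X_{tj},\qquad a,i,j=1,\dots,n.$$ Write $x_{ij}$ for the class of $X_{ij}$. $\mathcal{A}(\mathfrak{h})$ is a commutative bialgebra with $\Delta(x_{ij})=\sum_{s=1}^n x_{is}\otimes x_{sj}$ and $\varepsilon(x_{ij})=\delta_{i,j}$. *)

(* Defs.v *)
From HB Require Import structures.
From mathcomp Require Import all_boot all_order all_algebra all_fingroup.
From mathcomp Require Import generic_quotient ring_quotient.
From mathcomp Require classical_sets.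
From mathcomp Require Import boolp mpoly.

Set Implicit Arguments.
Unset Strict Implicit.
Unset Printing Implicit Defensive.

Import GRing.Theory.
Local Open Scope ring_scope.

Definition bilin (k : fieldType) (V W U : lmodType k) (f : V -> W -> U) : Prop :=
  (forall w, linear (f^~ w)) /\ (forall v, linear (f v)).

Section BilinTheory.
Variables (k : fieldType) (V W U : lmodType k) (f : V -> W -> U).
Hypothesis bf : bilin f.

Lemma bilinDl v v' w : f (v + v') w = f v w + f v' w.
Proof. by have := bf.1 w 1 v v'; rewrite !scale1r. Qed.
Lemma bilinDr v w w' : f v (w + w') = f v w + f v w'.
Proof. by have := bf.2 v 1 w w'; rewrite !scale1r. Qed.
Lemma bilin0l w : f 0 w = 0.
Proof. by apply: (addrI (f 0 w)); rewrite -bilinDl !addr0. Qed.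
Lemma bilin0r v : f v 0 = 0.
Proof. by apply: (addrI (f v 0)); rewrite -bilinDr !addr0. Qed.
Lemma bilinZl c v w : f (c *: v) w = c *: f v w.
Proof. by have := bf.1 w c v 0; rewrite bilin0l !addr0. Qed.
Lemma bilinZr c v w : f v (c *: w) = c *: f v w.
Proof. by have := bf.2 v c w 0; rewrite bilin0r !addr0. Qed.
Lemma bilin_suml I (r : seq I) (P : pred I) (F : I -> V) w :
  f (\sum_(i <- r | P i) F i) w = \sum_(i <- r | P i) f (F i) w.
Proof.
exact: (big_morph (fun v => f v w) (fun x y => bilinDl x y w) (bilin0l w)).
Qed.
Lemma bilin_sumr I (r : seq I) (P : pred I) (F : I -> W) v :
  f v (\sum_(i <- r | P i) F i) = \sum_(i <- r | P i) f v (F i).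
Proof. exact: (big_morph _ (bilinDr v) (bilin0r v)). Qed.
End BilinTheory.

Lemma bilinI (k : fieldType) (V W U : lmodType k) (f : V -> W -> U) :
  (forall v v' w, f (v + v') w = f v w + f v' w) ->
  (forall c v w, f (c *: v) w = c *: f v w) ->
  (forall v w w', f v (w + w') = f v w + f v w') ->
  (forall c v w, f v (c *: w) = c *: f v w) -> bilin f.
Proof.
move=> Dl Zl Dr Zr.
by split=> [w c x y|v c x y] /=; rewrite ?Dl ?Zl ?Dr ?Zr.
Qed.

Lemma linI (k : fieldType) (V U : lmodType k) (f : V -> U) :
  (forall v v', f (v + v') = f v + f v') ->
  (forall c v, f (c *: v) = c *: f v) -> linear f.
Proof. by move=> D Z c x y; rewrite D Z. Qed.

Section LinTheory.
Variables (k : fieldType) (V U : lmodType k) (f : V -> U).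
Hypothesis lf : linear f.
Lemma linfD v v' : f (v + v') = f v + f v'.
Proof. by have := lf 1 v v'; rewrite !scale1r. Qed.
Lemma linf0 : f 0 = 0.
Proof. by apply: (addrI (f 0)); rewrite -linfD !addr0. Qed.
Lemma linfZ c v : f (c *: v) = c *: f v.
Proof. by have := lf c v 0; rewrite linf0 !addr0. Qed.
Lemma linf_sum I (r : seq I) (P : pred I) (F : I -> V) :
  f (\sum_(i <- r | P i) F i) = \sum_(i <- r | P i) f (F i).
Proof. exact: (big_morph _ linfD linf0). Qed.
End LinTheory.

(* [:: (v1, w1); ...; (vm, wm)] stands for the formal sum of the vi (x) wi;
   teq is the congruence generated by the defining relations of V (x) W.      *)
Inductive teq (k : fieldType) (V W : lmodType k) :
    seq (V * W) -> seq (V * W) -> Prop :=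
| teq_refl s : teq s s
| teq_sym s t : teq s t -> teq t s
| teq_trans s t u : teq s t -> teq t u -> teq s u
| teq_cat s s' t t' : teq s s' -> teq t t' -> teq (s ++ t) (s' ++ t')
| teq_catC s t : teq (s ++ t) (t ++ s)
| teq_addl v v' w : teq [:: (v + v', w)] [:: (v, w); (v', w)]
| teq_addr v w w' : teq [:: (v, w + w')] [:: (v, w); (v, w')]
| teq_scale c v w : teq [:: (c *: v, w)] [:: (v, c *: w)]
| teq_zero w : teq [:: (0, w)] [::].

Definition teqb (k : fieldType) (V W : lmodType k) (s t : seq (V * W)) : bool :=
  `[< teq s t >].

Section TeqEquiv.
Variables (k : fieldType) (V W : lmodType k).
Lemma teqb_equiv : equiv_class_of (@teqb k V W).
Proof.
split.
- by move=> s; apply/asboolP; exact: teq_refl.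
- by move=> s t; apply/asboolP/asboolP; exact: teq_sym.
- by move=> t s u /asboolP h /asboolP h'; apply/asboolP; exact: teq_trans h h'.
Qed.
Canonical teqb_equivRel := EquivRelPack teqb_equiv.
Canonical teqb_encModRel := defaultEncModRel (@teqb k V W).
End TeqEquiv.

Definition tensor (k : fieldType) (V W : lmodType k) : Type :=
  {eq_quot (@teqb k V W)}%qT.
HB.instance Definition _ (k : fieldType) (V W : lmodType k) :=
  Choice.on (tensor V W).
HB.instance Definition _ (k : fieldType) (V W : lmodType k) :
  EqQuotient (seq (V * W)) (@teqb k V W) (tensor V W) := EqQuotient.on (tensor V W).

Notation "V ⊗ W" := (tensor V W) (at level 40, left associativity) : type_scope.

Section Tensor.
Variables (k : fieldType) (V W : lmodType k).
Implicit Types (s t : seq (V * W)) (x y z : V ⊗ W).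

Definition tclass s : V ⊗ W := (\pi_(V ⊗ W) s)%qT.
Definition tens v w : V ⊗ W := tclass [:: (v, w)].

Lemma tclass_eq s t : teq s t -> tclass s = tclass t.
Proof. by move=> h; rewrite /tclass; apply/eqmodP/asboolP. Qed.

Lemma teq_repr s : teq (repr (tclass s)) s.
Proof.
have : tclass (repr (tclass s)) = tclass s by exact: reprK.
by rewrite /tclass => /eqmodP/asboolP.
Qed.

Lemma tclassK x : tclass (repr x) = x.
Proof. exact: reprK. Qed.

Definition tadd x y := tclass (repr x ++ repr y).
Definition tzero := tclass [::].
Definition tscale (c : k) x := tclass [seq (c *: p.1, p.2) | p <- repr x].
Definition topp x := tscale (-1) x.

Lemma tadd_class s t : tadd (tclass s) (tclass t) = tclass (s ++ t).
Proof. by apply: tclass_eq; apply: teq_cat; exact: teq_repr. Qed.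

Lemma teq_scaleseq c s t : teq s t ->
  teq [seq (c *: p.1, p.2) | p <- s] [seq (c *: p.1, p.2) | p <- t].
Proof.
elim=> {s t} /=.
- by move=> s; exact: teq_refl.
- by move=> s t _; exact: teq_sym.
- by move=> s t u _ h _; exact: teq_trans h.
- by move=> s s' t t' _ h _ h'; rewrite !map_cat; exact: teq_cat.
- by move=> s t; rewrite !map_cat; exact: teq_catC.
- by move=> v v' w; rewrite scalerDr; exact: teq_addl.
- by move=> v w w'; exact: teq_addr.
- move=> d v w; rewrite scalerA mulrC -scalerA; exact: teq_scale.
- by move=> w; rewrite scaler0; exact: teq_zero.
Qed.

Lemma tscale_class c s : tscale c (tclass s) = tclass [seq (c *: p.1, p.2) | p <- s].
Proof. by apply: tclass_eq; apply: teq_scaleseq; exact: teq_repr. Qed.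

Lemma taddA : associative tadd.
Proof.
by move=> x y z; rewrite -[x]tclassK -[y]tclassK -[z]tclassK !tadd_class catA.
Qed.
Lemma taddC : commutative tadd.
Proof. by move=> x y; apply: tclass_eq; exact: teq_catC. Qed.
Lemma tadd0 : left_id tzero tadd.
Proof. by move=> x; rewrite -[x]tclassK tadd_class. Qed.

Lemma tscaleDl_class c d s :
  tclass [seq ((c + d) *: p.1, p.2) | p <- s] =
  tadd (tclass [seq (c *: p.1, p.2) | p <- s])
       (tclass [seq (d *: p.1, p.2) | p <- s]).
Proof.
have tc p t : tclass (p :: t) = tadd (tclass [:: p]) (tclass t) by rewrite tadd_class.
elim: s => [|[v w] s IH] /=; first by rewrite tadd_class.
rewrite tc IH scalerDl (tclass_eq (teq_addl _ _ _)) tc.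
rewrite (tc _ [:: _]) (tc _ [seq (d *: p.1, p.2) | p <- s]).
rewrite -!taddA; congr (tadd _ _).
by rewrite !taddA; congr (tadd _ _); rewrite taddC.
Qed.

Lemma tscale0_class s : tclass [seq (0 *: p.1, p.2) | p <- s] = tzero.
Proof.
elim: s => [//|[v w] s IH] /=.
by rewrite -cat1s -tadd_class IH scale0r (tclass_eq (teq_zero V w)) tadd0.
Qed.

Lemma tscale1_class s : [seq (1 *: p.1, p.2) | p <- s] = s.
Proof. by elim: s => [//|[v w] s /= ->]; rewrite scale1r. Qed.

Lemma taddN : left_inverse tzero topp tadd.
Proof.
move=> x; rewrite /topp -[x]tclassK tscale_class.
rewrite -[X in tadd _ (tclass X)]tscale1_class -tscaleDl_class addNr.
exact: tscale0_class.
Qed.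

HB.instance Definition _ := GRing.isZmodule.Build (V ⊗ W) taddA taddC tadd0 taddN.

Lemma tclassD s t : tclass (s ++ t) = tclass s + tclass t.
Proof. by rewrite -tadd_class. Qed.

Lemma tscaleA c d x : tscale c (tscale d x) = tscale (c * d) x.
Proof.
rewrite -[x]tclassK !tscale_class -map_comp; congr tclass.
by apply: eq_map => p /=; rewrite scalerA.
Qed.
Lemma tscale1 : left_id 1 tscale.
Proof. by move=> x; rewrite -[x]tclassK tscale_class tscale1_class. Qed.
Lemma tscaleDr : right_distributive tscale +%R.
Proof.
move=> c x y; rewrite -[x]tclassK -[y]tclassK.
by rewrite -tclassD !tscale_class map_cat tclassD.
Qed.
Lemma tscaleDl x : {morph tscale^~ x : c d / c + d}.
Proof. by move=> c d; rewrite -[x]tclassK !tscale_class tscaleDl_class. Qed.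

HB.instance Definition _ := GRing.Zmodule_isLmodule.Build k (V ⊗ W)
  tscaleA tscale1 tscaleDr tscaleDl.

Lemma tens_bilin : bilin tens.
Proof.
apply: bilinI => [v v' w|c v w|v w w'|c v w].
- by rewrite /tens (tclass_eq (teq_addl _ _ _)) -cat1s tclassD.
- by rewrite /tens [RHS]tscale_class.
- by rewrite /tens (tclass_eq (teq_addr _ _ _)) -cat1s tclassD.
- by rewrite /tens -(tclass_eq (teq_scale _ _ _)) [RHS]tscale_class.
Qed.

Lemma tclassE s : tclass s = \sum_(p <- s) tens p.1 p.2.
Proof.
elim: s => [|[v w] s IH]; first by rewrite big_nil.
by rewrite big_cons -IH -cat1s tclassD.
Qed.

Lemma tensorE x : x = \sum_(p <- repr x) tens p.1 p.2.
Proof. by rewrite -tclassE tclassK. Qed.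

Lemma tensor_ind (P : V ⊗ W -> Prop) :
  P 0 -> (forall x y, P x -> P y -> P (x + y)) -> (forall v w, P (tens v w)) ->
  forall x, P x.
Proof. by move=> P0 PD Pt x; rewrite (tensorE x); elim/big_ind: _. Qed.

(* The linear map out of V (x) W induced by f; meaningful for bilinear f,
   see tliftE. *)
Definition tlift (U : lmodType k) (f : V -> W -> U) x : U :=
  \sum_(p <- repr x) f p.1 p.2.

Section Lift.
Variables (U : lmodType k) (f : V -> W -> U).
Hypothesis bf : bilin f.

Lemma tlift_teq s t : teq s t ->
  \sum_(p <- s) f p.1 p.2 = \sum_(p <- t) f p.1 p.2.
Proof.
elim=> {s t} //=.
- by move=> s t u _ -> _ ->.
- by move=> s s' t t' _ h _ h'; rewrite !big_cat /= h h'.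
- by move=> s t; rewrite !big_cat /= addrC.
- by move=> v v' w; rewrite !big_cons !big_nil /= !addr0 (bilinDl bf).
- by move=> v w w'; rewrite !big_cons !big_nil /= !addr0 (bilinDr bf).
- by move=> c v w; rewrite !big_cons !big_nil /= !addr0 (bilinZl bf) (bilinZr bf).
- by move=> w; rewrite big_cons !big_nil /= addr0 (bilin0l bf).
Qed.

Lemma tlift_class s : tlift f (tclass s) = \sum_(p <- s) f p.1 p.2.
Proof. by apply: tlift_teq; exact: teq_repr. Qed.

Lemma tliftE v w : tlift f (tens v w) = f v w.
Proof. by rewrite tlift_class big_seq1. Qed.

Lemma tlift_linear : linear (tlift f).
Proof.
apply: linI => [x y|c x].
  by rewrite -[x]tclassK -[y]tclassK -tclassD !tlift_class big_cat.
rewrite -[x]tclassK [_ *: _]tscale_class !tlift_class big_map scaler_sumr.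
by apply: eq_bigr => p _; rewrite (bilinZl bf).
Qed.
End Lift.

Lemma tensor_lin_ext (U : lmodType k) (f g : V ⊗ W -> U) :
  linear f -> linear g -> (forall v w, f (tens v w) = g (tens v w)) -> f =1 g.
Proof.
move=> lf lg fg; elim/tensor_ind => [|x y IHx IHy|v w] //.
  by rewrite !linf0.
by rewrite !linfD // IHx IHy.
Qed.

Lemma eq_tlift (U : lmodType k) (f g : V -> W -> U) :
  f =2 g -> tlift f =1 tlift g.
Proof. by move=> fg x; apply: eq_bigr => p _; exact: fg. Qed.

Lemma tlift_lin (U U' : lmodType k) (f : V -> W -> U) (h : U -> U') x :
  linear h -> h (tlift f x) = tlift (fun v w => h (f v w)) x.
Proof. by move=> lh; rewrite /tlift linf_sum. Qed.

End Tensor.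

Infix "⊗t" := tens (at level 40, left associativity) : ring_scope.

Section LinearForms.
Import classical_sets.
Local Open Scope classical_set_scope.
Variables (k : fieldType) (V : lmodType k).

Lemma lin_form_ex (v : V) : v != 0 ->
  exists f : V -> k^o, linear f /\ f v = 1.
Proof.
move=> v0.
pose P (A : set V) :=
  (forall c x y, (x = 0 \/ A x) -> (y = 0 \/ A y) ->
     c *: x + y = 0 \/ A (c *: x + y)) /\ ~ A v.
have [F FP Ft|A [[Alin Av] Amax]] := @Zorn_bigcup V P.
  split=> [c x y|[B FB Bv]]; last by case: (FP B FB) => _; apply.
  move=> [->|[B FB Bx]] [->|[C FC Cy]].
  - by left; rewrite scaler0 addr0.
  - by right; exists C => //; rewrite scaler0 add0r.
  - have [h _] := FP B FB.
    by case: (h c x 0 (or_intror Bx) (or_introl erefl)) => ?; [left|right; exists B].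
  - have [BC|CB] := Ft B C FB FC.
      have [h _] := FP C FC.
      case: (h c x y (or_intror (BC _ Bx)) (or_intror Cy)) => ?; first by left.
      by right; exists C.
    have [h _] := FP B FB.
    case: (h c x y (or_intror Bx) (or_intror (CB _ Cy))) => ?; first by left.
    by right; exists B.
pose M x := x = 0 \/ A x.
have Mlin c x y : M x -> M y -> M (c *: x + y) by exact: Alin.
have M0 : M 0 by left.
have MD x y : M x -> M y -> M (x + y) by move=> ? ?; rewrite -[x]scale1r; exact: Mlin.
have MZ c x : M x -> M (c *: x) by move=> ?; rewrite -[_ *: _]addr0; exact: Mlin.
have Mv : ~ M v by case=> // ve; move: v0; rewrite ve eqxx.
have Mspan x : exists c : k^o, M (x - c *: v).
  have [Ax|nAx] := pselect (M x); first by exists 0; rewrite scale0r subr0.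
  pose B : set V := fun z => exists c m, M m /\ z = c *: x + m.
  have MB z : M z -> B z by exists 0, z; rewrite scale0r add0r.
  have Blin c z z' : B z -> B z' -> B (c *: z + z').
    move=> [d [m [Mm ->]]] [d' [m' [Mm' ->]]].
    exists (c * d + d'), (c *: m + m'); split; first exact: Mlin.
    by rewrite scalerDr scalerA addrACA scalerDl.
  have [Bv|nBv] := pselect (B v); last first.
    case: (Amax B); last first.
      split=> // c z z' Bz Bz'; right; apply: Blin.
        by case: Bz => // ->; exact: MB.
      by case: Bz' => // ->; exact: MB.
    split; first by move=> z Az; apply: MB; right.
    move=> BA; apply: nAx; right; apply: BA.
    by exists 1, 0; rewrite scale1r addr0.
  case: Bv => c [m [Mm ve]].
  have c0 : c != 0.
    by apply/eqP => c0; apply: Mv; rewrite ve c0 scale0r add0r.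
  exists (c^-1); rewrite ve scalerDr scalerA mulVf // scale1r opprD addrA subrr.
  by rewrite add0r -scalerN; apply: (MZ); rewrite -scaleN1r; exact: MZ.
have Muniq x (c d : k^o) : M (x - c *: v) -> M (x - d *: v) -> c = d.
  move=> Mc Md; apply/eqP; rewrite -subr_eq0; apply/negP => /negP cd.
  apply: Mv; have := MZ (c - d)^-1 _ (Mlin (-1) _ _ Mc Md).
  rewrite scaleN1r opprB addrA subrK -scalerBl scalerA mulVf //.
  by rewrite scale1r.
have [f fP] := choice Mspan.
exists f; split; last first.
  by apply: (@Muniq v) => //; rewrite scale1r subrr.
move=> c x y; apply: (Muniq (c *: x + y)) => //.
have := Mlin c _ _ (fP x) (fP y); congr M.
by rewrite scalerBr scalerA addrACA -opprD -scalerDl.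
Qed.
End LinearForms.

Section TensorAlgebra.
Variables (k : fieldType) (A B : algType k).
Implicit Types (x y z : A ⊗ B).

Definition tmul x y : A ⊗ B :=
  tlift (fun a b => tlift (fun a' b' => (a * a') ⊗t (b * b')) y) x.
Definition tone : A ⊗ B := 1 ⊗t 1.

Lemma tmul_bilin1 a b : bilin (fun a' b' => ((a * a') ⊗t (b * b') : A ⊗ B)).
Proof.
have tb := @tens_bilin k A B.
apply: bilinI => *; rewrite ?mulrDr -?scalerAr.
- by rewrite (bilinDl tb).
- by rewrite (bilinZl tb).
- by rewrite (bilinDr tb).
- by rewrite (bilinZr tb).
Qed.

Lemma tmul_bilin2 y :
  bilin (fun a b => tlift (fun a' b' => ((a * a') ⊗t (b * b') : A ⊗ B)) y).
Proof.
have tb := @tens_bilin k A B.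
apply: bilinI => *; rewrite /tlift -?big_split ?scaler_sumr /=;
  apply: eq_bigr => p _; rewrite ?mulrDl -?scalerAl.
- by rewrite (bilinDl tb).
- by rewrite (bilinZl tb).
- by rewrite (bilinDr tb).
- by rewrite (bilinZr tb).
Qed.

Lemma tmul_tens a b a' b' : tmul (a ⊗t b) (a' ⊗t b') = (a * a') ⊗t (b * b').
Proof. by rewrite /tmul (tliftE (tmul_bilin2 _)) (tliftE (tmul_bilin1 _ _)). Qed.

Lemma tmul_bilin : bilin tmul.
Proof.
split=> [y|x]; first exact: tlift_linear (tmul_bilin2 y).
move=> c y z; rewrite /tmul /tlift scaler_sumr -big_split /=.
by apply: eq_bigr => p _; exact: (tlift_linear (tmul_bilin1 p.1 p.2)).
Qed.

Let Dl := bilinDl tmul_bilin.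
Let Dr := bilinDr tmul_bilin.
Let Z0l := bilin0l tmul_bilin.
Let Z0r := bilin0r tmul_bilin.

Lemma tmulA : associative tmul.
Proof.
move=> x y z.
elim/tensor_ind: x => [|x x' IH IH'|a b]; first by rewrite !Z0l.
  by rewrite !Dl IH IH'.
elim/tensor_ind: y => [|y y' IH IH'|a' b']; first by rewrite Z0r !Z0l Z0r.
  by rewrite Dl !Dr Dl IH IH'.
elim/tensor_ind: z => [|z z' IH IH'|a'' b'']; first by rewrite !Z0r.
  by rewrite !Dr IH IH'.
by rewrite !tmul_tens !mulrA.
Qed.

Lemma tmul1 : left_id tone tmul.
Proof.
move=> x; elim/tensor_ind: x => [|x x' IH IH'|a b]; first by rewrite Z0r.
  by rewrite Dr IH IH'.
by rewrite tmul_tens !mul1r.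
Qed.

Lemma tmulr1 : right_id tone tmul.
Proof.
move=> x; elim/tensor_ind: x => [|x x' IH IH'|a b]; first by rewrite Z0l.
  by rewrite Dl IH IH'.
by rewrite tmul_tens !mulr1.
Qed.

Lemma tmulDl : left_distributive tmul +%R.
Proof. by move=> x y z; rewrite Dl. Qed.
Lemma tmulDr : right_distributive tmul +%R.
Proof. by move=> x y z; rewrite Dr. Qed.

Lemma tone_neq0 : tone != 0.
Proof.
apply/eqP => t0.
have [f [lf f1]] := lin_form_ex (oner_neq0 A).
have [g [lg g1]] := lin_form_ex (oner_neq0 B).
have bfg : bilin (fun a b => (f a * g b : k^o)).
  apply: bilinI => *; rewrite ?(linfD lf) ?(linfZ lf) ?(linfD lg) ?(linfZ lg).
  - by rewrite mulrDl.
  - by rewrite -scalerAl.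
  - by rewrite mulrDr.
  - by rewrite -scalerAr.
have := tliftE bfg 1 1; rewrite -/tone t0 (linf0 (tlift_linear bfg)) f1 g1 mulr1.
by move/esym/eqP; rewrite oner_eq0.
Qed.

HB.instance Definition _ := GRing.Zmodule_isNzRing.Build (A ⊗ B)
  tmulA tmul1 tmulr1 tmulDl tmulDr tone_neq0.

Lemma tensM a b a' b' : (a ⊗t b) * (a' ⊗t b') = (a * a') ⊗t (b * b') :> A ⊗ B.
Proof. exact: tmul_tens. Qed.

Lemma tscalerAl c x y : c *: (x * y) = (c *: x) * y.
Proof. by rewrite [RHS](bilinZl tmul_bilin). Qed.
HB.instance Definition _ := GRing.Lmodule_isLalgebra.Build k (A ⊗ B) tscalerAl.
Lemma tscalerAr c x y : c *: (x * y) = x * (c *: y).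
Proof. by rewrite [RHS](bilinZr tmul_bilin). Qed.
HB.instance Definition _ := GRing.Lalgebra_isAlgebra.Build k (A ⊗ B) tscalerAr.
End TensorAlgebra.

Section TensorComAlgebra.
Variables (k : fieldType) (A B : comAlgType k).
Lemma tmulC : commutative (@tmul k A B).
Proof.
move=> x y; rewrite -[LHS]/(x * y) -[RHS]/(y * x).
elim/tensor_ind: x => [|x x' IH IH'|a b]; first by rewrite mul0r mulr0.
  by rewrite mulrDl mulrDr IH IH'.
elim/tensor_ind: y => [|y y' IH IH'|a' b']; first by rewrite mul0r mulr0.
  by rewrite mulrDl mulrDr IH IH'.
by rewrite !tensM mulrC [b * _]mulrC.
Qed.
HB.instance Definition _ := GRing.PzRing_hasCommutativeMul.Build (A ⊗ B) tmulC.
End TensorComAlgebra.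

Definition tmap (k : fieldType) (V V' W W' : lmodType k)
    (f : V -> V') (g : W -> W') : V ⊗ W -> V' ⊗ W' :=
  tlift (fun v w => f v ⊗t g w).

Definition tassoc (k : fieldType) (U V W : lmodType k) :
    (U ⊗ V) ⊗ W -> U ⊗ (V ⊗ W) :=
  tlift (fun x w => tlift (fun u v => u ⊗t (v ⊗t w)) x).

HB.mixin Record Algebra_isBialgebra (k : fieldType) A of GRing.Algebra k A := {
  comul : {lrmorphism A -> A ⊗ A};
  counit : {lrmorphism A -> k^o};
  comulA : forall a : A,
    tassoc (tmap comul idfun (comul a)) = tmap idfun comul (comul a);
  counitl : forall a : A, tlift (fun a1 a2 => (counit a1 : k) *: a2) (comul a) = a;
  counitr : forall a : A, tlift (fun a1 a2 => (counit a2 : k) *: a1) (comul a) = a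
}.

#[short(type="bialgType")]
HB.structure Definition Bialgebra (k : fieldType) :=
  {A of Algebra_isBialgebra k A & GRing.Algebra k A}.

#[short(type="finDimBialgType")]
HB.structure Definition FinDimBialgebra (k : fieldType) :=
  {A of Bialgebra k A & Vector k A}.

Record bialg_hom (k : fieldType) (A B : bialgType k) := BialgHom {
  bialg_fun :> {lrmorphism A -> B};
  bialg_fun_comul : forall a, comul (bialg_fun a) = tmap bialg_fun bialg_fun (comul a);
  bialg_fun_counit : forall a, counit (bialg_fun a) = counit a
}.

Section TensorMaps.
Variable k : fieldType.

Lemma tlift_tmap (V V' W W' U : lmodType k) (F : V' -> W' -> U)
    (f : V -> V') (g : W -> W') x :
  bilin F -> tlift F (tmap f g x) = tlift (fun v w => F (f v) (g w)) x.
Proof.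
move=> bF; rewrite /tmap tlift_lin; last exact: tlift_linear.
by apply: eq_tlift => v w; rewrite tliftE.
Qed.

Lemma tlift_tassoc (V1 V2 V3 U : lmodType k) (F : V1 -> V2 ⊗ V3 -> U) x :
  bilin F ->
  tlift F (tassoc x) = tlift (fun y w => tlift (fun u v => F u (v ⊗t w)) y) x.
Proof.
move=> bF; rewrite /tassoc tlift_lin; last exact: tlift_linear.
apply: eq_tlift => y w; rewrite tlift_lin; last exact: tlift_linear.
by apply: eq_tlift => u v; rewrite tliftE.
Qed.

Lemma linfun_lin (V : vectType k) (f : V -> k^o) : linear f -> linfun f =1 f.
Proof.
move=> lf; pose F : {linear V -> k^o} := HB.pack f (GRing.isLinear.Build k V k^o _ f lf).
exact: (lfunE F).
Qed.

Lemma lmorE (U V : lmodType k) (f : {linear U -> V}) : linear f.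
Proof. exact: linearP. Qed.
Lemma eq_tliftk (V W : lmodType k) (f g : V -> W -> k^o) x :
  f =2 g -> tlift f x = tlift g x :> k.
Proof. by move=> fg; apply: eq_bigr => p _; exact: fg. Qed.
End TensorMaps.

Definition dual (k : fieldType) (H : finDimBialgType k) : Type := 'Hom(H, k^o).
HB.instance Definition _ (k : fieldType) (H : finDimBialgType k) :=
  Vector.on (dual H).

Section Dual.
Variables (k : fieldType) (H : finDimBialgType k).
Implicit Types (f g h : dual H) (x y z : H).

Definition dual_ev f x : k := (f : 'Hom(H, k^o)) x.
Local Notation "f @@ x" := (dual_ev f x) (at level 10).

Lemma dual_ext f g : (forall x, f @@ x = g @@ x) -> f = g.
Proof. by move=> fg; apply/lfunP. Qed.

Definition dual_of (F : H -> k) : dual H := linfun (F : H -> k^o).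
Lemma dual_ofE (F : H -> k) x : linear (F : H -> k^o) -> dual_of F @@ x = F x.
Proof. by move=> lF; rewrite /dual_ev linfun_lin. Qed.

Lemma dual_evDl f g x : (f + g) @@ x = f @@ x + g @@ x.
Proof. by rewrite /dual_ev lfunE. Qed.
Lemma dual_evZl c f x : (c *: f) @@ x = c * f @@ x.
Proof. by rewrite /dual_ev lfunE. Qed.
Lemma dual_evDr f x y : f @@ (x + y) = f @@ x + f @@ y.
Proof. by rewrite /dual_ev linearD. Qed.
Lemma dual_evZr c f x : f @@ (c *: x) = c * f @@ x.
Proof. by rewrite /dual_ev linearZ. Qed.
Lemma dual_ev_linear f : linear (fun x => dual_ev f x : k^o).
Proof. by apply: linI => *; rewrite ?dual_evDr ?dual_evZr. Qed.
Lemma dual_evl_linear x : linear (fun f => dual_ev f x : k^o).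
Proof. by apply: linI => *; rewrite ?dual_evDl ?dual_evZl. Qed.

Lemma dual_bilin f g : bilin (fun x y => (f @@ x * g @@ y : k^o)).
Proof.
apply: bilinI => *; rewrite ?dual_evDr ?dual_evZr ?mulrDl ?mulrDr //.
  by rewrite -mulrA.
by rewrite mulrCA.
Qed.

(* product of the dual: (f g)(x) = (f (x) g)(Delta x); unit: epsilon *)
Definition dual_mul f g : dual H :=
  dual_of (fun x => tlift (fun a b => (f @@ a * g @@ b : k^o)) (comul x)).
Definition dual_one : dual H := dual_of (fun x => counit x).

Lemma dual_mulE f g x :
  dual_mul f g @@ x = tlift (fun a b => (f @@ a * g @@ b : k^o)) (comul x).
Proof.
rewrite dual_ofE //; apply: linI => [v w|c v].
  by rewrite linearD (linfD (tlift_linear (dual_bilin f g))).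
by rewrite linearZ (linfZ (tlift_linear (dual_bilin f g))).
Qed.

Lemma dual_oneE x : dual_one @@ x = counit x.
Proof. by rewrite dual_ofE //; exact: lmorE. Qed.

Lemma dual_mulA : associative dual_mul.
Proof.
move=> f g h; apply: dual_ext => x.
pose F a (y : H ⊗ H) : k^o := f @@ a * tlift (fun b c => (g @@ b * h @@ c : k^o)) y.
have lgh := tlift_linear (dual_bilin g h).
have bF : bilin F.
  apply: bilinI => *; rewrite /F ?dual_evDr ?dual_evZr ?mulrDl //.
  - by rewrite -mulrA.
  - by rewrite (linfD lgh) mulrDr.
  - by rewrite (linfZ lgh) mulrCA.
transitivity (tlift F (tmap idfun comul (comul x))).
  rewrite tlift_tmap // dual_mulE; apply: eq_tliftk => a b.
  by rewrite /F dual_mulE.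
rewrite -comulA tlift_tassoc // [LHS]tlift_tmap; last first.
  split=> [w|y].
    apply: tlift_linear; split => [v c a b|a c v v'].
      by rewrite bF.1.
    by rewrite (tens_bilin _ _).1 bF.2.
  move=> c w w'; rewrite /tlift scaler_sumr -big_split; apply: eq_bigr => p _ /=.
  by rewrite (tens_bilin _ _).2 bF.2.
rewrite dual_mulE; apply: eq_tliftk => a b; rewrite dual_mulE /tlift mulr_suml.
by apply: eq_bigr => p _; rewrite /F tliftE ?mulrA //; exact: dual_bilin.
Qed.

Lemma dual_mul1 : left_id dual_one dual_mul.
Proof.
move=> f; apply: dual_ext => x; rewrite dual_mulE -[in RHS](counitl x).
rewrite [RHS](@tlift_lin _ _ _ _ k^o _ (dual_ev f)); last exact: dual_ev_linear.
by apply: eq_tliftk => a b; rewrite dual_oneE dual_evZr.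
Qed.

Lemma dual_mulr1 : right_id dual_one dual_mul.
Proof.
move=> f; apply: dual_ext => x; rewrite dual_mulE -[in RHS](counitr x).
rewrite [RHS](@tlift_lin _ _ _ _ k^o _ (dual_ev f)); last exact: dual_ev_linear.
by apply: eq_tliftk => a b; rewrite dual_oneE dual_evZr mulrC.
Qed.

Lemma dual_mulDl : left_distributive dual_mul +%R.
Proof.
move=> f f' g; apply: dual_ext => x; rewrite dual_evDl !dual_mulE /tlift.
by rewrite -big_split; apply: eq_bigr => p _; rewrite dual_evDl mulrDl.
Qed.

Lemma dual_mulDr : right_distributive dual_mul +%R.
Proof.
move=> f g g'; apply: dual_ext => x; rewrite dual_evDl !dual_mulE /tlift.
by rewrite -big_split; apply: eq_bigr => p _; rewrite dual_evDl mulrDr.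
Qed.

Lemma dual_one_neq0 : dual_one != 0.
Proof.
apply/eqP => d0; have := dual_oneE 1.
rewrite d0 rmorph1 /dual_ev zero_lfunE => /esym/eqP.
by rewrite oner_eq0.
Qed.

HB.instance Definition _ := GRing.Zmodule_isNzRing.Build (dual H)
  dual_mulA dual_mul1 dual_mulr1 dual_mulDl dual_mulDr dual_one_neq0.

Lemma dualM f g x : (f * g) @@ x = tlift (fun a b => (f @@ a * g @@ b : k^o)) (comul x).
Proof. exact: dual_mulE. Qed.
Lemma dual1E x : 1 @@ x = counit x.
Proof. exact: dual_oneE. Qed.

Lemma dual_scalerAl c f g : c *: (f * g) = (c *: f) * g.
Proof.
apply: dual_ext => x; rewrite dual_evZl !dualM /tlift mulr_sumr.
by apply: eq_bigr => p _; rewrite dual_evZl mulrA.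
Qed.
HB.instance Definition _ := GRing.Lmodule_isLalgebra.Build k (dual H) dual_scalerAl.
Lemma dual_scalerAr c f g : c *: (f * g) = f * (c *: g).
Proof.
apply: dual_ext => x; rewrite dual_evZl !dualM /tlift mulr_sumr.
by apply: eq_bigr => p _; rewrite dual_evZl mulrCA.
Qed.
HB.instance Definition _ := GRing.Lalgebra_isAlgebra.Build k (dual H) dual_scalerAr.

Definition dual_ev2 (t : dual H ⊗ dual H) x y : k :=
  tlift (fun f g => (f @@ x * g @@ y : k^o)) t.

Lemma dual_ev2_bilin x y : bilin (fun f g : dual H => (f @@ x * g @@ y : k^o)).
Proof.
apply: bilinI => *; rewrite ?dual_evDl ?dual_evZl ?mulrDl ?mulrDr //.
  by rewrite -mulrA.
by rewrite mulrCA.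
Qed.

Lemma dual_ev2_linear x y : linear (fun t => dual_ev2 t x y : k^o).
Proof. exact: tlift_linear (dual_ev2_bilin x y). Qed.
Lemma dual_ev2D t t' x y : dual_ev2 (t + t') x y = dual_ev2 t x y + dual_ev2 t' x y.
Proof. exact: (linfD (dual_ev2_linear x y)). Qed.
Lemma dual_ev2Z c t x y : dual_ev2 (c *: t) x y = c * dual_ev2 t x y.
Proof. exact: (linfZ (dual_ev2_linear x y)). Qed.
Lemma dual_ev20 x y : dual_ev2 0 x y = 0.
Proof. exact: (linf0 (dual_ev2_linear x y)). Qed.
Lemma dual_ev2E f g x y : dual_ev2 (f ⊗t g) x y = f @@ x * g @@ y.
Proof. exact: (tliftE (dual_ev2_bilin x y)). Qed.

Local Notation N := (\dim {:H}).
Local Notation b := (vbasis {:H}).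
Definition dual_basis (i : 'I_N) : dual H := dual_of (fun x => coord b i x).

Lemma dual_basisE i x : dual_basis i @@ x = coord b i x.
Proof. by rewrite dual_ofE //; apply: linI => *; rewrite ?linearD ?linearZ. Qed.

Lemma dual_expand f : f = \sum_(i < N) f @@ b`_i *: dual_basis i.
Proof.
apply: dual_ext => x; rewrite [in LHS](coord_vbasis (memvf x)).
rewrite (linf_sum (dual_ev_linear f)) (linf_sum (dual_evl_linear x)).
by apply: eq_bigr => i _; rewrite dual_evZr dual_evZl dual_basisE mulrC.
Qed.

Lemma dual_ev2K (t : dual H ⊗ dual H) :
  t = \sum_(i < N) \sum_(j < N) dual_ev2 t b`_i b`_j *: (dual_basis i ⊗t dual_basis j).
Proof.
have tb := @tens_bilin k (dual H) (dual H).
elim/tensor_ind: t => [|t t' IH IH'|f g].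
- by rewrite big1 // => i _; rewrite big1 // => j _; rewrite dual_ev20 scale0r.
- rewrite {1}IH {1}IH' -big_split; apply: eq_bigr => i _ /=.
  by rewrite -big_split; apply: eq_bigr => j _ /=; rewrite dual_ev2D scalerDl.
rewrite {1}(dual_expand f) (bilin_suml tb); apply: eq_bigr => i _.
rewrite {1}(dual_expand g) (bilin_sumr tb); apply: eq_bigr => j _.
by rewrite (bilinZl tb) (bilinZr tb) scalerA dual_ev2E.
Qed.

Lemma dual_ev2_ext t t' :
  (forall x y, dual_ev2 t x y = dual_ev2 t' x y) -> t = t'.
Proof.
move=> h; rewrite (dual_ev2K t) (dual_ev2K t').
by apply: eq_bigr => i _; apply: eq_bigr => j _; rewrite h.
Qed.

(* coproduct of the dual, determined by <Delta f, x (x) y> = f (x y), see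
   dual_comulE; counit: f |-> f 1 *)
Definition dual_comul f : dual H ⊗ dual H :=
  \sum_(i < N) \sum_(j < N) f @@ (b`_i * b`_j) *: (dual_basis i ⊗t dual_basis j).
Definition dual_counit f : k^o := f @@ 1.

Lemma dual_comulE f x y : dual_ev2 (dual_comul f) x y = f @@ (x * y).
Proof.
rewrite /dual_comul (linf_sum (dual_ev2_linear x y)).
rewrite [in RHS](coord_vbasis (memvf x)) mulr_suml (linf_sum (dual_ev_linear f)).
apply: eq_bigr => i _; rewrite (linf_sum (dual_ev2_linear x y)).
rewrite [in RHS](coord_vbasis (memvf y)) mulr_sumr (linf_sum (dual_ev_linear f)).
apply: eq_bigr => j _; rewrite dual_ev2Z dual_ev2E !dual_basisE.
by rewrite -scalerAl -scalerAr !dual_evZr [RHS]mulrA mulrC.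
Qed.

Lemma dual_ev2M t t' x y :
  dual_ev2 (t * t') x y =
  tlift (fun x1 x2 => tlift (fun y1 y2 =>
    (dual_ev2 t x1 y1 * dual_ev2 t' x2 y2 : k^o)) (comul y)) (comul x).
Proof.
elim/tensor_ind: t => [|s s' IH IH'|f g].
- rewrite mul0r dual_ev20 /tlift big1 // => p _; rewrite big1 // => q _.
  by rewrite dual_ev20 mul0r.
- rewrite mulrDl dual_ev2D IH IH' /tlift -big_split; apply: eq_bigr => p _ /=.
  by rewrite -big_split; apply: eq_bigr => q _ /=; rewrite dual_ev2D mulrDl.
elim/tensor_ind: t' => [|s s' IH IH'|f' g'].
- rewrite mulr0 dual_ev20 /tlift big1 // => p _; rewrite big1 // => q _.
  by rewrite dual_ev20 mulr0.
- rewrite mulrDr dual_ev2D IH IH' /tlift -big_split; apply: eq_bigr => p _ /=.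
  by rewrite -big_split; apply: eq_bigr => q _ /=; rewrite dual_ev2D mulrDr.
rewrite tensM dual_ev2E !dualM /tlift mulr_suml; apply: eq_bigr => p _ /=.
rewrite mulr_sumr; apply: eq_bigr => q _ /=.
by rewrite !dual_ev2E mulrACA.
Qed.

Lemma dual_comul_linear : linear dual_comul.
Proof.
move=> c f g; apply: dual_ev2_ext => x y; rewrite dual_ev2D dual_ev2Z !dual_comulE.
by rewrite dual_evDl dual_evZl.
Qed.
HB.instance Definition _ :=
  GRing.isLinear.Build k (dual H) (dual H ⊗ dual H) _ dual_comul dual_comul_linear.

Lemma tliftM_ev (F : H -> H -> k^o) (u v : H ⊗ H) : bilin F ->
  tlift F (u * v) =
  tlift (fun x1 x2 => tlift (fun y1 y2 => F (x1 * y1) (x2 * y2)) v) u.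
Proof.
move=> bF; have lF := tlift_linear bF.
rewrite [u * v]/(tmul u v) /tmul tlift_lin //; apply: eq_bigr => p _.
by rewrite /= tlift_lin //; apply: eq_bigr => q _; rewrite tliftE.
Qed.

Lemma dual_comul_mul : monoid_morphism dual_comul.
Proof.
split=> [|f g]; apply: dual_ev2_ext => x y; rewrite dual_comulE.
  by rewrite dual_ev2E !dual1E rmorphM.
rewrite dualM rmorphM /= tliftM_ev; last exact: dual_bilin.
rewrite dual_ev2M; apply: eq_bigr => p _; apply: eq_bigr => q _.
by rewrite !dual_comulE.
Qed.
HB.instance Definition _ :=
  GRing.isMonoidMorphism.Build (dual H) (dual H ⊗ dual H) dual_comul dual_comul_mul.

Lemma dual_counit_linear : linear dual_counit.
Proof. exact: dual_evl_linear. Qed.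
HB.instance Definition _ :=
  GRing.isLinear.Build k (dual H) k^o _ dual_counit dual_counit_linear.

Lemma dual_counit_mul : monoid_morphism dual_counit.
Proof.
rewrite /dual_counit; split=> [|f g]; first by rewrite dual1E rmorph1.
by rewrite dualM rmorph1 (tliftE (dual_bilin f g)).
Qed.
HB.instance Definition _ :=
  GRing.isMonoidMorphism.Build (dual H) k^o dual_counit dual_counit_mul.

Definition dual_slice x (t : dual H ⊗ (dual H ⊗ dual H)) : dual H ⊗ dual H :=
  tlift (fun f s => f @@ x *: s) t.

Lemma dual_slice_bilin x :
  bilin (fun f (s : dual H ⊗ dual H) => f @@ x *: s).
Proof.
apply: bilinI => *; rewrite ?dual_evDl ?dual_evZl ?scalerDl ?scalerDr ?scalerA //.
by rewrite mulrC.
Qed.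

Lemma dual_sliceK t : t = \sum_(i < N) dual_basis i ⊗t dual_slice b`_i t.
Proof.
have tb := @tens_bilin k (dual H) (dual H ⊗ dual H).
elim/tensor_ind: t => [|t t' IH IH'|f s].
- rewrite big1 // => i _; rewrite /dual_slice.
  by rewrite (linf0 (tlift_linear (dual_slice_bilin _))) (bilin0r tb).
- rewrite {1}IH {1}IH' -big_split; apply: eq_bigr => i _ /=.
  by rewrite /dual_slice (linfD (tlift_linear (dual_slice_bilin _))) (bilinDr tb).
rewrite {1}(dual_expand f) (bilin_suml tb); apply: eq_bigr => i _.
by rewrite /dual_slice (tliftE (dual_slice_bilin _)) (bilinZl tb) (bilinZr tb).
Qed.

Lemma dual_ev2_slice x y z t :
  dual_ev2 (dual_slice x t) y z =
  tlift (fun f s => (f @@ x * dual_ev2 s y z : k^o)) t.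
Proof.
rewrite /dual_slice (@tlift_lin _ _ _ _ _ _ (fun t => dual_ev2 t y z : k^o)).
  by apply: eq_tliftk => f s; rewrite dual_ev2Z.
exact: dual_ev2_linear.
Qed.

Lemma dual_ev3_bilin x y z :
  bilin (fun f (s : dual H ⊗ dual H) => (f @@ x * dual_ev2 s y z : k^o)).
Proof.
apply: bilinI => *; rewrite ?dual_evDl ?dual_evZl ?dual_ev2D ?dual_ev2Z.
- by rewrite mulrDl.
- by rewrite -mulrA.
- by rewrite mulrDr.
- by rewrite mulrCA.
Qed.

Lemma dual_comulA f :
  tassoc (tmap dual_comul idfun (dual_comul f)) =
  tmap idfun dual_comul (dual_comul f).
Proof.
rewrite [LHS]dual_sliceK [RHS]dual_sliceK; apply: eq_bigr => i _; congr (_ ⊗t _).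
move: b`_i => x; apply: dual_ev2_ext => y z; rewrite !dual_ev2_slice.
have bF := dual_ev3_bilin x y z.
rewrite tlift_tassoc // [RHS]tlift_tmap // [LHS]tlift_tmap; last first.
  split=> [w|s].
    apply: tlift_linear; split => [v c a a'|a c v v'].
      by rewrite bF.1.
    by rewrite (tens_bilin _ _).1 bF.2.
  move=> c w w'; rewrite /tlift scaler_sumr -big_split; apply: eq_bigr => p _ /=.
  by rewrite (tens_bilin _ _).2 bF.2.
transitivity (dual_ev2 (dual_comul f) (x * y) z).
  apply: eq_tliftk => g w /=; rewrite -dual_comulE /dual_ev2 [in RHS]/tlift mulr_suml.
  apply: eq_bigr => p _; rewrite (tliftE (dual_ev2_bilin _ _)) mulrA //.
transitivity (dual_ev2 (dual_comul f) x (y * z)).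
  by rewrite !dual_comulE mulrA.
by apply: eq_tliftk => g w /=; rewrite dual_comulE.
Qed.

Lemma dual_counitl f :
  tlift (fun f1 f2 => (dual_counit f1 : k) *: f2) (dual_comul f) = f.
Proof.
apply: dual_ext => x.
rewrite (@tlift_lin _ _ _ _ _ _ (fun g => dual_ev g x : k^o)); last exact: dual_evl_linear.
rewrite -[in RHS](mul1r x) -dual_comulE; apply: eq_tliftk => g h.
by rewrite dual_evZl.
Qed.

Lemma dual_counitr f :
  tlift (fun f1 f2 => (dual_counit f2 : k) *: f1) (dual_comul f) = f.
Proof.
apply: dual_ext => x.
rewrite (@tlift_lin _ _ _ _ _ _ (fun g => dual_ev g x : k^o)); last exact: dual_evl_linear.
rewrite -[in RHS](mulr1 x) -dual_comulE; apply: eq_tliftk => g h.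
by rewrite dual_evZl mulrC.
Qed.

HB.instance Definition _ := @Algebra_isBialgebra.Build k (dual H)
  dual_comul dual_counit dual_comulA dual_counitl dual_counitr.
End Dual.

Definition group_alg (k : fieldType) (gT : finGroupType) : Type :=
  {ffun gT -> k^o}.
HB.instance Definition _ (k : fieldType) (gT : finGroupType) :=
  Vector.on (group_alg k gT).

Section GroupAlgebra.
Variables (k : fieldType) (gT : finGroupType).
Implicit Types (g : gT) (x y z : group_alg k gT).

Definition galg_elt g : group_alg k gT := [ffun h => (h == g)%:R].
Definition galg_mul x y : group_alg k gT :=
  \sum_g \sum_h (x g * y h) *: galg_elt (g * h)%g.
Definition galg_one : group_alg k gT := galg_elt 1%g.

Lemma galg_expand x : x = \sum_g (x g : k) *: galg_elt g.
Proof.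
apply/ffunP => h; rewrite sum_ffunE (bigD1 h) //= !ffunE eqxx.
rewrite -[LHS]mulr1 [X in _ + X]big1 ?addr0 // => g gh.
by rewrite !ffunE eq_sym (negbTE gh) [LHS]mulr0.
Qed.

Lemma galg_ind (P : group_alg k gT -> Prop) :
  P 0 -> (forall x y, P x -> P y -> P (x + y)) ->
  (forall c g, P (c *: galg_elt g)) -> forall x, P x.
Proof. by move=> P0 PD Pe x; rewrite (galg_expand x); elim/big_ind: _. Qed.

Lemma galg_mul_bilin : bilin galg_mul.
Proof.
apply: bilinI => [x x' y|c x y|x y y'|c x y]; rewrite /galg_mul -?big_split ?scaler_sumr;
  apply: eq_bigr => g _ /=; rewrite -?big_split ?scaler_sumr;
  apply: eq_bigr => h _ /=.
- by rewrite ffunE mulrDl scalerDl.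
- by rewrite ffunE scalerA mulrA.
- by rewrite ffunE mulrDr scalerDl.
- by rewrite ffunE scalerA mulrCA.
Qed.

Let Dl := bilinDl galg_mul_bilin.
Let Dr := bilinDr galg_mul_bilin.
Let Z0l := bilin0l galg_mul_bilin.
Let Z0r := bilin0r galg_mul_bilin.
Let Zl := bilinZl galg_mul_bilin.
Let Zr := bilinZr galg_mul_bilin.

Lemma galg_mul_elt g h : galg_mul (galg_elt g) (galg_elt h) = galg_elt (g * h)%g.
Proof.
rewrite /galg_mul (bigD1 g) //= (bigD1 h) //= !ffunE !eqxx mulr1 scale1r.
rewrite [X in _ + X + _]big1 => [|h' hh']; last first.
  by rewrite ffunE (negbTE hh') mulr0 scale0r.
rewrite big1 ?addr0 // => g' gg'; rewrite big1 // => h' _.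
by rewrite ffunE (negbTE gg') mul0r scale0r.
Qed.

Lemma galg_mulA : associative galg_mul.
Proof.
move=> x y z.
elim/galg_ind: x => [|x x' IH IH'|c g]; first by rewrite !Z0l.
  by rewrite !Dl IH IH'.
elim/galg_ind: y => [|y y' IH IH'|d h]; first by rewrite Z0r !Z0l Z0r.
  by rewrite Dl !Dr Dl IH IH'.
elim/galg_ind: z => [|z z' IH IH'|a l]; first by rewrite !Z0r.
  by rewrite !Dr IH IH'.
by rewrite !Zl !Zr !Zl !galg_mul_elt mulgA !scalerA mulrAC.
Qed.

Lemma galg_mul1 : left_id galg_one galg_mul.
Proof.
move=> x; elim/galg_ind: x => [|x x' IH IH'|c g]; first by rewrite Z0r.
  by rewrite Dr IH IH'.
by rewrite Zr galg_mul_elt mul1g.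
Qed.

Lemma galg_mulr1 : right_id galg_one galg_mul.
Proof.
move=> x; elim/galg_ind: x => [|x x' IH IH'|c g]; first by rewrite Z0l.
  by rewrite Dl IH IH'.
by rewrite Zl galg_mul_elt mulg1.
Qed.

Lemma galg_mulDl : left_distributive galg_mul +%R.
Proof. by move=> x y z; rewrite Dl. Qed.
Lemma galg_mulDr : right_distributive galg_mul +%R.
Proof. by move=> x y z; rewrite Dr. Qed.
Lemma galg_one_neq0 : galg_one != 0.
Proof.
apply/eqP => /ffunP /(_ 1%g); rewrite !ffunE eqxx => /eqP.
by rewrite oner_eq0.
Qed.
HB.instance Definition _ := GRing.Zmodule_isNzRing.Build (group_alg k gT)
  galg_mulA galg_mul1 galg_mulr1 galg_mulDl galg_mulDr galg_one_neq0.

Lemma galg_eltM g h : galg_elt g * galg_elt h = galg_elt (g * h)%g.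
Proof. exact: galg_mul_elt. Qed.

Lemma galg_scalerAl (c : k) x y : c *: (x * y) = (c *: x) * y.
Proof. by rewrite [RHS]Zl. Qed.
HB.instance Definition _ :=
  GRing.Lmodule_isLalgebra.Build k (group_alg k gT) galg_scalerAl.
Lemma galg_scalerAr (c : k) x y : c *: (x * y) = x * (c *: y).
Proof. by rewrite [RHS]Zr. Qed.
HB.instance Definition _ :=
  GRing.Lalgebra_isAlgebra.Build k (group_alg k gT) galg_scalerAr.

(* group elements are group-like: Delta g = g (x) g, epsilon g = 1 *)
Definition galg_comul x : group_alg k gT ⊗ group_alg k gT :=
  \sum_g (x g : k) *: (galg_elt g ⊗t galg_elt g).
Definition galg_counit x : k^o := \sum_g x g.

Lemma galg_comul_linear : linear galg_comul.
Proof.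
move=> c x y; rewrite /galg_comul scaler_sumr -big_split; apply: eq_bigr => g _ /=.
by rewrite !ffunE scalerDl scalerA.
Qed.
HB.instance Definition _ := GRing.isLinear.Build k (group_alg k gT)
  (group_alg k gT ⊗ group_alg k gT) _ galg_comul galg_comul_linear.

Lemma galg_comul_elt g : galg_comul (galg_elt g) = galg_elt g ⊗t galg_elt g.
Proof.
rewrite /galg_comul (bigD1 g) //= big1 ?addr0 => [|h hg].
  by rewrite ffunE eqxx scale1r.
by rewrite ffunE (negbTE hg) scale0r.
Qed.

Lemma galg_comul_mul : monoid_morphism galg_comul.
Proof.
split=> [|x y]; first exact: galg_comul_elt.
elim/galg_ind: x => [|x x' IH IH'|c g]; first by rewrite linear0 !mul0r linear0.
  by rewrite linearD !mulrDl linearD /= IH IH'.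
elim/galg_ind: y => [|y y' IH IH'|d h]; first by rewrite linear0 !mulr0 linear0.
  by rewrite linearD !mulrDr linearD /= IH IH'.
rewrite -scalerAl -scalerAr galg_eltM !linearZ /= !galg_comul_elt.
by rewrite -scalerAl -scalerAr tensM !galg_eltM.
Qed.
HB.instance Definition _ := GRing.isMonoidMorphism.Build (group_alg k gT)
  (group_alg k gT ⊗ group_alg k gT) galg_comul galg_comul_mul.

Lemma galg_counit_linear : linear galg_counit.
Proof.
move=> c x y; rewrite /galg_counit scaler_sumr -big_split; apply: eq_bigr => g _ /=.
by rewrite !ffunE.
Qed.
HB.instance Definition _ := GRing.isLinear.Build k (group_alg k gT)
  k^o _ galg_counit galg_counit_linear.

Lemma galg_counit_elt g : galg_counit (galg_elt g) = 1.
Proof.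
rewrite /galg_counit (bigD1 g) //= big1 ?addr0 => [|h hg].
  by rewrite ffunE eqxx.
by rewrite ffunE (negbTE hg).
Qed.

Lemma galg_counit_mul : monoid_morphism galg_counit.
Proof.
split=> [|x y]; first exact: galg_counit_elt.
elim/galg_ind: x => [|x x' IH IH'|c g]; first by rewrite linear0 !mul0r linear0.
  by rewrite linearD !mulrDl linearD /= IH IH'.
elim/galg_ind: y => [|y y' IH IH'|d h]; first by rewrite linear0 !mulr0 linear0.
  by rewrite linearD !mulrDr linearD /= IH IH'.
rewrite -scalerAl -scalerAr galg_eltM !linearZ /= !galg_counit_elt.
by rewrite -scalerAl -scalerAr mulr1.
Qed.
HB.instance Definition _ := GRing.isMonoidMorphism.Build (group_alg k gT)
  k^o galg_counit galg_counit_mul.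

Lemma galg_lin_ext (U : lmodType k) (f f' : group_alg k gT -> U) :
  linear f -> linear f' -> (forall g, f (galg_elt g) = f' (galg_elt g)) -> f =1 f'.
Proof.
move=> lf lf' ff'; elim/galg_ind => [|x y IH IH'|c g].
- by rewrite !linf0.
- by rewrite !linfD // IH IH'.
- by rewrite !linfZ // ff'.
Qed.

End GroupAlgebra.

Section TensorMaps2.
Variable k : fieldType.

Lemma linear_comp (U V W : lmodType k) (f : V -> W) (g : U -> V) :
  linear f -> linear g -> linear (fun x => f (g x)).
Proof. by move=> lf lg c x y; rewrite lg lf. Qed.

Lemma tmap_bilin (V V' W W' : lmodType k) (f : V -> V') (g : W -> W') :
  linear f -> linear g -> bilin (fun v w => f v ⊗t g w).
Proof.
move=> lf lg; have tb := @tens_bilin k V' W'.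
by split=> [w c v v'|v c w w'] /=; rewrite ?lf ?lg ?tb.1 ?tb.2.
Qed.
Lemma tmap_linear (V V' W W' : lmodType k) (f : V -> V') (g : W -> W') :
  linear f -> linear g -> linear (tmap f g).
Proof. by move=> lf lg; apply: tlift_linear; exact: tmap_bilin. Qed.
Lemma tmapE (V V' W W' : lmodType k) (f : V -> V') (g : W -> W') v w :
  linear f -> linear g -> tmap f g (v ⊗t w) = f v ⊗t g w.
Proof. by move=> lf lg; rewrite /tmap tliftE //; exact: tmap_bilin. Qed.

Lemma tassoc_bilin1 (U V W : lmodType k) (w : W) :
  bilin (fun (u : U) (v : V) => u ⊗t (v ⊗t w)).
Proof.
have tb := @tens_bilin k V W; have tb' := @tens_bilin k U (V ⊗ W).
by split=> [v c u u'|u c v v'] /=; rewrite ?tb.1 ?tb'.1 ?tb'.2.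
Qed.
Lemma tassoc_bilin (U V W : lmodType k) :
  bilin (fun x (w : W) => tlift (fun (u : U) (v : V) => u ⊗t (v ⊗t w)) x).
Proof.
split=> [w|x]; first exact: tlift_linear (tassoc_bilin1 U V w).
move=> c w w'; rewrite /tlift scaler_sumr -big_split; apply: eq_bigr => p _ /=.
by rewrite (tens_bilin _ _).2 (tens_bilin _ _).2.
Qed.
Lemma tassoc_linear (U V W : lmodType k) : linear (@tassoc k U V W).
Proof. exact: tlift_linear (tassoc_bilin _ _ _). Qed.
Lemma tassocE (U V W : lmodType k) (u : U) (v : V) (w : W) :
  tassoc ((u ⊗t v) ⊗t w) = u ⊗t (v ⊗t w).
Proof.
by rewrite /tassoc (tliftE (tassoc_bilin _ _ _)) (tliftE (tassoc_bilin1 _ _ w)).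
Qed.

Lemma tliftM (A B C : algType k) (F : A -> B -> C) x y : bilin F ->
  (forall a a' b b', F (a * a') (b * b') = F a b * F a' b') ->
  tlift F (x * y) = tlift F x * tlift F y.
Proof.
move=> bF FM; have lF := tlift_linear bF.
elim/tensor_ind: x => [|x x' IH IH'|a b]; first by rewrite mul0r (linf0 lF) mul0r.
  by rewrite mulrDl !(linfD lF) mulrDl IH IH'.
elim/tensor_ind: y => [|y y' IH IH'|a' b']; first by rewrite mulr0 (linf0 lF) mulr0.
  by rewrite mulrDr !(linfD lF) mulrDr IH IH'.
by rewrite tensM !tliftE.
Qed.

Lemma tmapM (A A' B B' : algType k) (f : {lrmorphism A -> A'}) (g : {lrmorphism B -> B'}) x y :
  tmap f g (x * y) = tmap f g x * tmap f g y.
Proof.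
apply: tliftM; first by apply: tmap_bilin; exact: lmorE.
by move=> a a' b b'; rewrite tensM !rmorphM.
Qed.

Lemma tassocM (A B C : algType k) (x y : (A ⊗ B) ⊗ C) :
  tassoc (x * y) = tassoc x * tassoc y.
Proof.
have l := @tassoc_linear A B C; have tb := @tens_bilin k (A ⊗ B) C.
elim/tensor_ind: x => [|x x' IH IH'|t c]; first by rewrite mul0r (linf0 l) mul0r.
  by rewrite mulrDl !(linfD l) mulrDl IH IH'.
elim/tensor_ind: y => [|y y' IH IH'|t' c']; first by rewrite mulr0 (linf0 l) mulr0.
  by rewrite mulrDr !(linfD l) mulrDr IH IH'.
elim/tensor_ind: t => [|t s IH IH'|a b]; first by rewrite (bilin0l tb) mul0r (linf0 l) mul0r.
  by rewrite (bilinDl tb) mulrDl !(linfD l) mulrDl IH IH'.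
elim/tensor_ind: t' => [|t s IH IH'|a' b']; first by rewrite (bilin0l tb) mulr0 (linf0 l) mulr0.
  by rewrite (bilinDl tb) mulrDr !(linfD l) mulrDr IH IH'.
by rewrite !tensM !tassocE !tensM.
Qed.
End TensorMaps2.

Section GroupAlgebraBialg.
Variables (k : fieldType) (gT : finGroupType).
Local Notation kG := (group_alg k gT).

Lemma galg_comulA (x : kG) :
  tassoc (tmap (@galg_comul k gT) idfun (galg_comul x)) =
  tmap idfun (@galg_comul k gT) (galg_comul x).
Proof.
have lc := @galg_comul_linear k gT; have li : linear (idfun : kG -> kG) by [].
move: x; apply: galg_lin_ext.
- apply: linear_comp; first exact: tassoc_linear.
  by apply: linear_comp => //; exact: tmap_linear.
- by apply: linear_comp => //; exact: tmap_linear.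
by move=> g; rewrite galg_comul_elt !tmapE // galg_comul_elt tassocE.
Qed.

Lemma galg_counitl_bilin :
  bilin (fun x y : kG => (galg_counit x : k) *: y).
Proof.
apply: bilinI => *.
- by rewrite linearD scalerDl.
- by rewrite linearZ scalerA.
- by rewrite scalerDr.
- by rewrite !scalerA mulrC.
Qed.

Lemma galg_counitr_bilin :
  bilin (fun x y : kG => (galg_counit y : k) *: x).
Proof.
apply: bilinI => *.
- by rewrite scalerDr.
- by rewrite !scalerA mulrC.
- by rewrite linearD scalerDl.
- by rewrite linearZ scalerA.
Qed.

Lemma galg_counitl (x : kG) :
  tlift (fun x1 x2 => (galg_counit x1 : k) *: x2) (galg_comul x) = x.
Proof.
move: x; apply: (@galg_lin_ext k gT kG) => //.
  apply: linear_comp; first exact: tlift_linear galg_counitl_bilin.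
  exact: galg_comul_linear.
move=> g; rewrite galg_comul_elt (tliftE galg_counitl_bilin).
by rewrite galg_counit_elt scale1r.
Qed.

Lemma galg_counitr (x : kG) :
  tlift (fun x1 x2 => (galg_counit x2 : k) *: x1) (galg_comul x) = x.
Proof.
move: x; apply: (@galg_lin_ext k gT kG) => //.
  apply: linear_comp; first exact: tlift_linear galg_counitr_bilin.
  exact: galg_comul_linear.
move=> g; rewrite galg_comul_elt (tliftE galg_counitr_bilin).
by rewrite galg_counit_elt scale1r.
Qed.

HB.instance Definition _ := @Algebra_isBialgebra.Build k kG
  (@galg_comul k gT) (@galg_counit k gT) galg_comulA galg_counitl galg_counitr.
End GroupAlgebraBialg.

Section UniversalAlgebra.
Variables (k : fieldType) (n : nat) (tau : 'I_n -> 'I_n -> 'I_n -> k).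

Definition univ_var (i j : 'I_n) : {mpoly k[n * n]} := 'X_(mxvec_index i j).

(* tau i j s stands for tau_{i,j}^s *)
Definition univ_rel (a i j : 'I_n) : {mpoly k[n * n]} :=
  \sum_(u < n) tau i j u *: univ_var a u -
  \sum_(s < n) \sum_(t < n) tau s t a *: (univ_var s i * univ_var t j).

Definition univ_ideal : {pred {mpoly k[n * n]}} := fun p =>
  `[< exists c : 'I_n -> 'I_n -> 'I_n -> {mpoly k[n * n]},
        p = \sum_(a < n) \sum_(i < n) \sum_(j < n) c a i j * univ_rel a i j >].

Section Eval.
Variables (B : comAlgType k) (V : 'M[B]_n).
Definition univ_eval (p : {mpoly k[n * n]}) : B :=
  mmap (GRing.in_alg B) (fun v => mxvec V 0 v) p.
HB.instance Definition _ := GRing.RMorphism.copy univ_eval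
  (mmap (GRing.in_alg B) (fun v => mxvec V 0 v)).

Lemma univ_evalX i j : univ_eval (univ_var i j) = V i j.
Proof. by rewrite /univ_eval /univ_var mmapX mmap1U mxvecE. Qed.
Lemma univ_evalZ c p : univ_eval (c *: p) = c *: univ_eval p.
Proof. by rewrite /univ_eval mmapZ /= mulr_algl. Qed.

Lemma univ_eval_rel a i j : univ_eval (univ_rel a i j) =
  \sum_(u < n) tau i j u *: V a u -
  \sum_(s < n) \sum_(t < n) tau s t a *: (V s i * V t j).
Proof.
rewrite rmorphB !rmorph_sum /=; congr (_ - _).
  by apply: eq_bigr => u _; rewrite univ_evalZ univ_evalX.
apply: eq_bigr => s _; rewrite rmorph_sum /=; apply: eq_bigr => t _.
by rewrite univ_evalZ rmorphM /= !univ_evalX.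
Qed.

Definition univ_compat := forall a i j,
  \sum_(u < n) tau i j u *: V a u =
  \sum_(s < n) \sum_(t < n) tau s t a *: (V s i * V t j).

Lemma univ_eval_ideal p : univ_compat -> p \in univ_ideal -> univ_eval p = 0.
Proof.
move=> cV /asboolP[c ->]; rewrite rmorph_sum big1 // => a _.
rewrite rmorph_sum big1 // => i _; rewrite rmorph_sum big1 // => j _.
by rewrite rmorphM /= univ_eval_rel cV subrr mulr0.
Qed.
End Eval.

Lemma univ_compat1 : univ_compat (1%:M : 'M[k^o]_n).
Proof.
move=> a i j; rewrite (bigD1 a) //= big1 ?addr0 => [|u ua]; last first.
  by rewrite mxE eq_sym (negbTE ua) scaler0.
rewrite (bigD1 i) //= (bigD1 j) //= !mxE !eqxx mulr1.
rewrite [X in _ = _ + X + _]big1 ?addr0 => [|t tj]; last first.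
  by rewrite !mxE (negbTE tj) mulr0 scaler0.
rewrite big1 ?addr0 // => s si; rewrite big1 // => t _.
by rewrite !mxE (negbTE si) mul0r scaler0.
Qed.

Lemma univ_idealr_closed : idealr_closed univ_ideal.
Proof.
split.
- apply/asboolP; exists (fun _ _ _ => 0); rewrite big1 // => a _.
  by rewrite big1 // => i _; rewrite big1 // => j _; rewrite mul0r.
- apply/negP => /(univ_eval_ideal univ_compat1) /eqP.
  by rewrite rmorph1 oner_eq0.
- move=> q p p' /asboolP[c ->] /asboolP[c' ->]; apply/asboolP.
  exists (fun a i j => q * c a i j + c' a i j).
  rewrite mulr_sumr -big_split; apply: eq_bigr => a _ /=.
  rewrite mulr_sumr -big_split; apply: eq_bigr => i _ /=.
  rewrite mulr_sumr -big_split; apply: eq_bigr => j _ /=.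
  by rewrite mulrDl mulrA.
Qed.
HB.instance Definition _ := isIdealr.Build _ univ_ideal univ_idealr_closed.

Definition univ_alg : Type := {ideal_quot univ_ideal}.
HB.instance Definition _ := GRing.ComNzRing.on univ_alg.

Definition univ_class (p : {mpoly k[n * n]}) : univ_alg :=
  (\pi_({ideal_quot univ_ideal}) p)%qT.
HB.instance Definition _ := GRing.RMorphism.copy univ_class
  (\pi_({ideal_quot univ_ideal}))%qT.

Definition univ_scale (c : k) (x : univ_alg) : univ_alg := univ_class c%:MP * x.
Lemma univ_scaleA c d x : univ_scale c (univ_scale d x) = univ_scale (c * d) x.
Proof. by rewrite /univ_scale mulrA -rmorphM /= mpolyCM. Qed.
Lemma univ_scale1 : left_id 1 univ_scale.
Proof. by move=> x; rewrite /univ_scale mpolyC1 rmorph1 mul1r. Qed.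
Lemma univ_scaleDr : right_distributive univ_scale +%R.
Proof. by move=> c x y; rewrite /univ_scale mulrDr. Qed.
Lemma univ_scaleDl x : {morph univ_scale^~ x : c d / c + d}.
Proof. by move=> c d; rewrite /univ_scale mpolyCD rmorphD mulrDl. Qed.
HB.instance Definition _ := GRing.Zmodule_isLmodule.Build k univ_alg
  univ_scaleA univ_scale1 univ_scaleDr univ_scaleDl.
Lemma univ_scalerAl (c : k) (x y : univ_alg) : c *: (x * y) = (c *: x) * y.
Proof. exact: mulrA. Qed.
HB.instance Definition _ := GRing.Lmodule_isLalgebra.Build k univ_alg univ_scalerAl.
HB.instance Definition _ := GRing.Lalgebra_isComAlgebra.Build k univ_alg.

Definition univ_gen (i j : 'I_n) : univ_alg := univ_class (univ_var i j).

Lemma univ_classZ c p : univ_class (c *: p) = c *: univ_class p.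
Proof. by rewrite -mul_mpolyC rmorphM. Qed.

Lemma univ_class_repr (x : univ_alg) : exists p, x = univ_class p.
Proof. by exists (repr x); rewrite /univ_class reprK. Qed.

Lemma univ_class_eq0 p : p \in univ_ideal -> univ_class p = 0.
Proof.
move=> pJ; rewrite -(rmorph0 univ_class) /univ_class.
by apply/eqP; rewrite -Quotient.idealrBE subr0.
Qed.

Lemma univ_gen_compat : univ_compat (\matrix_(i, j) univ_gen i j).
Proof.
move=> a i j; apply/eqP; rewrite -subr_eq0; apply/eqP.
have /univ_class_eq0 : univ_rel a i j \in univ_ideal.
  apply/asboolP; exists (fun a' i' j' => ((a' == a) && (i' == i) && (j' == j))%:R).
  rewrite (bigD1 a) //= (bigD1 i) //= (bigD1 j) //= !eqxx mul1r.
  rewrite big1 ?addr0 => [|j' jj]; last by rewrite (negbTE jj) mul0r.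
  rewrite big1 ?addr0 => [|i' ii]; last first.
    by rewrite big1 // => j' _; rewrite (negbTE ii) mul0r.
  rewrite big1 ?addr0 // => a' aa; rewrite big1 // => i' _; rewrite big1 // => j' _.
  by rewrite (negbTE aa) mul0r.
rewrite rmorphB !rmorph_sum /= => h; rewrite -[RHS]h; congr (_ - _).
  by apply: eq_bigr => u _; rewrite mxE univ_classZ.
apply: eq_bigr => s _; rewrite rmorph_sum /=; apply: eq_bigr => t _.
by rewrite !mxE univ_classZ rmorphM.
Qed.

Lemma univ_ind (P : univ_alg -> Prop) :
  (forall c : k, P c%:A) -> (forall x y, P x -> P y -> P (x + y)) ->
  (forall x y, P x -> P y -> P (x * y)) -> (forall i j, P (univ_gen i j)) ->
  forall x, P x.
Proof.
move=> PC PD PM Pg x; have [p ->] := univ_class_repr x.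
have P1 : P 1 by rewrite -[1]scale1r.
elim/mpolyind: p => [|c m p _ _ IH]; first by rewrite rmorph0 -[0](scale0r 1).
rewrite rmorphD /= univ_classZ; apply: (PD) => //.
rewrite -mulr_algl; apply: (PM) => //; rewrite mpolyXE_id rmorph_prod /=.
elim/big_ind: _ => // v _; rewrite rmorphXn /=.
have Pv : P (univ_class 'X_v) by case/mxvec_indexP: v => i j; exact: Pg.
by elim: (m v) => [|e IHe]; rewrite ?expr0 // exprS; apply: PM.
Qed.

Section Lift.
Variables (B : comAlgType k) (V : 'M[B]_n).
Definition univ_lift (x : univ_alg) : B := univ_eval V (repr x).
Hypothesis cV : univ_compat V.

Lemma univ_lift_class p : univ_lift (univ_class p) = univ_eval V p.
Proof.
apply/eqP; rewrite -subr_eq0 -rmorphB; apply/eqP.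
apply: univ_eval_ideal => //; rewrite Quotient.idealrBE; apply/eqP.
by rewrite -[LHS]/(\pi_({ideal_quot univ_ideal}) _)%qT reprK.
Qed.

Lemma univ_lift_gen i j : univ_lift (univ_gen i j) = V i j.
Proof. by rewrite univ_lift_class univ_evalX. Qed.

Lemma univ_lift_linear : linear univ_lift.
Proof.
move=> c x y; have [p ->] := univ_class_repr x; have [q ->] := univ_class_repr y.
by rewrite -univ_classZ -rmorphD !univ_lift_class rmorphD /= univ_evalZ.
Qed.

Lemma univ_lift_mul : monoid_morphism univ_lift.
Proof.
split=> [|x y]; first by rewrite -(rmorph1 univ_class) univ_lift_class rmorph1.
have [p ->] := univ_class_repr x; have [q ->] := univ_class_repr y.
by rewrite -rmorphM !univ_lift_class rmorphM.
Qed.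
End Lift.

Definition univ_comul_mx : 'M[univ_alg ⊗ univ_alg]_n :=
  \matrix_(i, j) \sum_(s < n) univ_gen i s ⊗t univ_gen s j.
Definition univ_comul : univ_alg -> univ_alg ⊗ univ_alg := univ_lift univ_comul_mx.
Definition univ_counit : univ_alg -> k^o := univ_lift (1%:M : 'M[k^o]_n).

Lemma univ_comul_compat : univ_compat univ_comul_mx.
Proof.
have tb := @tens_bilin k univ_alg univ_alg.
have rel a i j : \sum_(u < n) tau i j u *: univ_gen a u =
    \sum_(s < n) \sum_(t < n) tau s t a *: (univ_gen s i * univ_gen t j).
  have := univ_gen_compat a i j.
  under eq_bigr do rewrite mxE.
  by under [RHS]eq_bigr do (under eq_bigr do rewrite !mxE).
move=> a i j.
transitivity (\sum_(s < n) univ_gen a s ⊗t \sum_(u < n) tau i j u *: univ_gen s u).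
  under eq_bigr do rewrite mxE scaler_sumr.
  rewrite exchange_big; apply: eq_bigr => s _; rewrite (bilin_sumr tb).
  by apply: eq_bigr => u _; rewrite (bilinZr tb).
transitivity (\sum_(p < n) \sum_(q < n)
    (\sum_(s < n) tau p q s *: univ_gen a s) ⊗t (univ_gen p i * univ_gen q j)).
  under eq_bigr do rewrite rel (bilin_sumr tb).
  rewrite exchange_big; apply: eq_bigr => p _ /=.
  under eq_bigr do rewrite (bilin_sumr tb).
  rewrite exchange_big; apply: eq_bigr => q _ /=.
  by rewrite (bilin_suml tb); apply: eq_bigr => s _; rewrite (bilinZr tb) (bilinZl tb).
transitivity (\sum_(p < n) \sum_(q < n) \sum_(s < n) \sum_(t < n)
    tau s t a *: ((univ_gen s p * univ_gen t q) ⊗t (univ_gen p i * univ_gen q j))).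
  apply: eq_bigr => p _; apply: eq_bigr => q _; rewrite rel (bilin_suml tb).
  apply: eq_bigr => s _; rewrite (bilin_suml tb).
  by apply: eq_bigr => t _; rewrite (bilinZl tb).
transitivity (\sum_(s < n) \sum_(t < n) \sum_(p < n) \sum_(q < n)
    tau s t a *: ((univ_gen s p * univ_gen t q) ⊗t (univ_gen p i * univ_gen q j))).
  under eq_bigr do rewrite exchange_big.
  rewrite exchange_big; apply: eq_bigr => s _ /=.
  under eq_bigr do rewrite exchange_big.
  by rewrite exchange_big.
apply: eq_bigr => s _; apply: eq_bigr => t _; rewrite !mxE mulr_suml scaler_sumr.
apply: eq_bigr => p _; rewrite mulr_sumr scaler_sumr; apply: eq_bigr => q _.
by rewrite tensM.
Qed.

HB.instance Definition _ := GRing.isLinear.Build k univ_alg (univ_alg ⊗ univ_alg) _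
  univ_comul (univ_lift_linear univ_comul_compat).
HB.instance Definition _ := GRing.isMonoidMorphism.Build univ_alg (univ_alg ⊗ univ_alg)
  univ_comul (univ_lift_mul univ_comul_compat).
HB.instance Definition _ := GRing.isLinear.Build k univ_alg k^o _
  univ_counit (univ_lift_linear univ_compat1).
HB.instance Definition _ := GRing.isMonoidMorphism.Build univ_alg k^o
  univ_counit (univ_lift_mul univ_compat1).

Lemma univ_comul_gen i j :
  univ_comul (univ_gen i j) = \sum_(s < n) univ_gen i s ⊗t univ_gen s j.
Proof. by rewrite /univ_comul (univ_lift_gen univ_comul_compat) mxE. Qed.

Lemma univ_counit_gen i j : univ_counit (univ_gen i j) = (i == j)%:R.
Proof. by rewrite /univ_counit (univ_lift_gen univ_compat1) mxE. Qed.

Lemma univ_lrm_ext (B : algType k) (f g : univ_alg -> B) :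
  linear f -> linear g -> monoid_morphism f -> monoid_morphism g ->
  (forall i j, f (univ_gen i j) = g (univ_gen i j)) -> f =1 g.
Proof.
move=> lf lg mf mg fg; apply: univ_ind => // [c|x y fx fy|x y fx fy].
- by rewrite !linfZ // mf.1 mg.1.
- by rewrite !linfD // fx fy.
- by rewrite mf.2 mg.2 fx fy.
Qed.

Lemma univ_comulA x :
  tassoc (tmap univ_comul idfun (univ_comul x)) =
  tmap idfun univ_comul (univ_comul x).
Proof.
have lc := lmorE univ_comul; have li : linear (idfun : univ_alg -> univ_alg) by [].
have tb := @tens_bilin k.
have la := @tassoc_linear k univ_alg univ_alg univ_alg.
have lt1 : linear (tmap univ_comul (idfun : univ_alg -> univ_alg)) by exact: tmap_linear.
have lt2 : linear (tmap (idfun : univ_alg -> univ_alg) univ_comul) by exact: tmap_linear.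
move: x; apply: univ_lrm_ext.
- by do 2![apply: linear_comp => //].
- by apply: linear_comp.
- split=> [|x y]; last by rewrite rmorphM /= tmapM tassocM.
  by rewrite rmorph1 tmapE //= rmorph1 tassocE.
- split=> [|x y]; last by rewrite rmorphM /= tmapM.
  by rewrite rmorph1 tmapE //= rmorph1.
move=> i j; rewrite univ_comul_gen (linf_sum lt1) (linf_sum lt2) (linf_sum la).
transitivity (\sum_(s < n) \sum_(t < n)
    univ_gen i t ⊗t (univ_gen t s ⊗t univ_gen s j)).
  apply: eq_bigr => s _; rewrite tmapE //= univ_comul_gen.
  rewrite (bilin_suml (tb _ _)) (linf_sum la).
  by apply: eq_bigr => t _; rewrite tassocE.
rewrite exchange_big; apply: eq_bigr => s _ /=; rewrite tmapE // univ_comul_gen.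
by rewrite (bilin_sumr (tb _ _)).
Qed.

Lemma univ_counitl_bilin :
  bilin (fun x y : univ_alg => (univ_counit x : k) *: y).
Proof.
apply: bilinI => *.
- by rewrite linearD scalerDl.
- by rewrite linearZ scalerA.
- by rewrite scalerDr.
- by rewrite !scalerA mulrC.
Qed.

Lemma univ_counitr_bilin :
  bilin (fun x y : univ_alg => (univ_counit y : k) *: x).
Proof.
apply: bilinI => *.
- by rewrite scalerDr.
- by rewrite !scalerA mulrC.
- by rewrite linearD scalerDl.
- by rewrite linearZ scalerA.
Qed.

Lemma univ_counitl x :
  tlift (fun x1 x2 => (univ_counit x1 : k) *: x2) (univ_comul x) = x.
Proof.
have lb := tlift_linear univ_counitl_bilin.
move: x; apply: (@univ_lrm_ext univ_alg) => //.
- by apply: linear_comp => //; exact: lmorE.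
- split=> [|x y]; first by rewrite rmorph1 (tliftE univ_counitl_bilin) rmorph1 scale1r.
  rewrite rmorphM /= tliftM //; first exact: univ_counitl_bilin.
  by move=> a a' b b'; rewrite rmorphM /= -scalerA -scalerAr -scalerAl scalerAr.
move=> i j; rewrite univ_comul_gen (linf_sum lb) (bigD1 i) //= big1 ?addr0 => [|s si].
  by rewrite (tliftE univ_counitl_bilin) univ_counit_gen eqxx scale1r.
by rewrite (tliftE univ_counitl_bilin) univ_counit_gen eq_sym (negbTE si) scale0r.
Qed.

Lemma univ_counitr x :
  tlift (fun x1 x2 => (univ_counit x2 : k) *: x1) (univ_comul x) = x.
Proof.
have lb := tlift_linear univ_counitr_bilin.
move: x; apply: (@univ_lrm_ext univ_alg) => //.
- by apply: linear_comp => //; exact: lmorE.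
- split=> [|x y]; first by rewrite rmorph1 (tliftE univ_counitr_bilin) rmorph1 scale1r.
  rewrite rmorphM /= tliftM //; first exact: univ_counitr_bilin.
  by move=> a a' b b'; rewrite rmorphM /= -scalerA -scalerAr -scalerAl scalerAr.
move=> i j; rewrite univ_comul_gen (linf_sum lb) (bigD1 j) //= big1 ?addr0 => [|s si].
  by rewrite (tliftE univ_counitr_bilin) univ_counit_gen eqxx scale1r.
by rewrite (tliftE univ_counitr_bilin) univ_counit_gen (negbTE si) scale0r.
Qed.

HB.instance Definition _ := @Algebra_isBialgebra.Build k univ_alg
  univ_comul univ_counit univ_comulA univ_counitl univ_counitr.
End UniversalAlgebra.

HB.mixin Record Lmodule_isLeibniz (k : fieldType) h of GRing.Lmodule k h := {
  lbracket : h -> h -> h;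
  lbracket_bilin : bilin lbracket;
  lbracketP : forall x y z, lbracket x (lbracket y z) =
    lbracket (lbracket x y) z - lbracket (lbracket x z) y
}.

#[short(type="leibnizType")]
HB.structure Definition Leibniz (k : fieldType) :=
  {h of Lmodule_isLeibniz k h & GRing.Lmodule k h}.

#[short(type="finDimLeibnizType")]
HB.structure Definition FinDimLeibniz (k : fieldType) :=
  {h of Leibniz k h & Vector k h}.

Record lbz_aut (k : fieldType) (h : leibnizType k) := LbzAut {
  lbz_aut_fun :> h -> h;
  lbz_aut_linear : linear lbz_aut_fun;
  lbz_aut_bij : bijective lbz_aut_fun;
  lbz_aut_bracket : {morph lbz_aut_fun : x y / lbracket x y}
}.

Section LbzAutGroup.
Variables (k : fieldType) (h : leibnizType k).
Implicit Types f g : lbz_aut h.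

HB.instance Definition _ := gen_eqMixin (lbz_aut h).
HB.instance Definition _ := gen_choiceMixin (lbz_aut h).

Lemma lbz_aut_ext f g : f =1 g -> f = g.
Proof.
case: f g => [f lf bf mf] [g lg bg mg] /= /funext fg; subst g.
by congr LbzAut; exact: Prop_irrelevance.
Qed.

Definition lbz_aut_one : lbz_aut h :=
  @LbzAut k h id (fun c x y => erefl) (Bijective (fun x => erefl) (fun x => erefl))
    (fun x y => erefl).

Lemma lbz_aut_mul_linear f g : linear (f \o g).
Proof. by move=> c x y /=; rewrite !lbz_aut_linear. Qed.
Lemma lbz_aut_mul_bracket f g : {morph f \o g : x y / lbracket x y}.
Proof. by move=> x y /=; rewrite !lbz_aut_bracket. Qed.
Definition lbz_aut_mul f g : lbz_aut h :=
  LbzAut (lbz_aut_mul_linear f g) (bij_comp (lbz_aut_bij f) (lbz_aut_bij g))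
    (lbz_aut_mul_bracket f g).

Lemma lbz_aut_inv_ex f : exists f' : h -> h, cancel f f' /\ cancel f' f.
Proof. by case: (lbz_aut_bij f) => f' fK f'K; exists f'. Qed.
Definition lbz_aut_inv_fun f : h -> h := projT1 (cid (lbz_aut_inv_ex f)).
Lemma lbz_aut_invK f : cancel f (lbz_aut_inv_fun f).
Proof. by rewrite /lbz_aut_inv_fun; case: cid => f' []. Qed.
Lemma lbz_aut_invKV f : cancel (lbz_aut_inv_fun f) f.
Proof. by rewrite /lbz_aut_inv_fun; case: cid => f' []. Qed.
Lemma lbz_aut_inv_linear f : linear (lbz_aut_inv_fun f).
Proof.
move=> c x y; apply: (can_inj (lbz_aut_invK f)).
by rewrite lbz_aut_linear !lbz_aut_invKV.
Qed.
Lemma lbz_aut_inv_bracket f : {morph lbz_aut_inv_fun f : x y / lbracket x y}.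
Proof.
move=> x y; apply: (can_inj (lbz_aut_invK f)).
by rewrite lbz_aut_bracket !lbz_aut_invKV.
Qed.
Definition lbz_aut_inv f : lbz_aut h :=
  LbzAut (lbz_aut_inv_linear f) (Bijective (lbz_aut_invKV f) (lbz_aut_invK f))
    (lbz_aut_inv_bracket f).

Lemma lbz_aut_mulA : associative lbz_aut_mul.
Proof. by move=> f g f'; exact: lbz_aut_ext. Qed.
Lemma lbz_aut_mul1 : left_id lbz_aut_one lbz_aut_mul.
Proof. by move=> f; exact: lbz_aut_ext. Qed.
Lemma lbz_aut_mulr1 : right_id lbz_aut_one lbz_aut_mul.
Proof. by move=> f; exact: lbz_aut_ext. Qed.
Lemma lbz_aut_mulV : left_inverse lbz_aut_one lbz_aut_inv lbz_aut_mul.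
Proof. by move=> f; apply: lbz_aut_ext => x; exact: lbz_aut_invK. Qed.
Lemma lbz_aut_mulrV : right_inverse lbz_aut_one lbz_aut_inv lbz_aut_mul.
Proof. by move=> f; apply: lbz_aut_ext => x; exact: lbz_aut_invKV. Qed.

HB.instance Definition _ := isGroup.Build (lbz_aut h)
  lbz_aut_mulA lbz_aut_mul1 lbz_aut_mulr1 lbz_aut_mulV lbz_aut_mulrV.
End LbzAutGroup.

(* tau_{i,j}^s, the coefficient of e_s in [e_i, e_j] *)
Definition struct_const (k : fieldType) (h : finDimLeibnizType k) (n : nat)
    (e : n.-tuple h) (i j s : 'I_n) : k :=
  coord e s (lbracket (tnth e i) (tnth e j)).

(* Main.v *)
(* A linear map into k[G]^* amounts to a G-indexed family of linear forms, and
   one that is multiplicative amounts to a family of characters.  Characters of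
   A(h) are the matrices satisfying the defining relations, i.e. the matrices
   of Leibniz endomorphisms of h.  Compatibility with the counit and with the
   coproduct of A(h) says that the identity of G goes to the identity matrix
   and that products go to products, so the matrices are invertible and the
   family is an action by automorphisms. *)
From HB Require Import structures.
Require Import Defs.
From mathcomp Require Import all_boot all_order all_algebra all_fingroup.
From mathcomp Require Import boolp mpoly.

Set Implicit Arguments.
Unset Strict Implicit.
Unset Printing Implicit Defensive.

Import GRing.Theory.
Local Open Scope ring_scope.

(** * Extensionality of bundled morphisms *)

Lemma multiplicative_ext (G H : magmaType) (f f' : {multiplicative G -> H}) :
  f =1 f' -> f = f'.
Proof.
case: f f' => f [[fM]] [f' [[f'M]]] /= /funext ff'; subst f'.
by rewrite (Prop_irrelevance fM f'M).
Qed.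

Lemma lrmorphism_ext (k : fieldType) (A B : algType k)
  (f f' : {lrmorphism A -> B}) : f =1 f' -> f = f'.
Proof.
case: f f' => f [[[f0 fD]] [[f1 fM]] [fZ]] [f' [[[f'0 f'D]] [[f'1 f'M]] [f'Z]]].
move=> /= /funext ff'; subst f'.
rewrite (Prop_irrelevance f0 f'0) (Prop_irrelevance fD f'D).
rewrite (Prop_irrelevance f1 f'1) (Prop_irrelevance fM f'M).
by rewrite (Prop_irrelevance fZ f'Z).
Qed.

(** The bijection compares bundled maps by equality; once the underlying algebra maps agree, only
    proofs of propositions remain to be identified. *)
Lemma bialg_hom_ext (k : fieldType) (A B : bialgType k) (f f' : bialg_hom A B) :
  f =1 f' -> f = f'.
Proof.
case: f f' => f fD fe [f' f'D f'e] /= /lrmorphism_ext ff'; subst f'.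
by congr BialgHom; exact: Prop_irrelevance.
Qed.

(** * The dual of the group algebra as functions on the group *)

Section GroupAlgebraDual.
Variables (k : fieldType) (G : finGroupType).
Local Notation kG := (group_alg k G).
Local Notation "f @@ g" := (dual_ev f (galg_elt k g)) (at level 10).
Implicit Types (f : dual kG) (g : G).

Lemma dual_galg_ext f f' : (forall g, f @@ g = f' @@ g) -> f = f'.
Proof.
move=> ff'; apply: dual_ext; apply: (@galg_lin_ext k G k^o) => //.
  exact: dual_ev_linear.
exact: dual_ev_linear.
Qed.

(** Group elements are group-like, so the convolution product is pointwise and evaluation at [g] is
    a character. *)
Lemma dual_galgM f f' g : (f * f') @@ g = f @@ g * f' @@ g.
Proof.
rewrite dualM [comul _]galg_comul_elt.
by rewrite (tliftE (dual_bilin f f')).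
Qed.

Lemma dual_galg1 g : (1 : dual kG) @@ g = 1.
Proof. by rewrite dual1E; exact: galg_counit_elt. Qed.

(** Linear extension from the basis [G], inverse to restricting a linear form to the group
    elements. *)
Definition dual_galg (F : G -> k) : dual kG :=
  dual_of (fun x : kG => \sum_g (x g : k) * F g).

Lemma dual_galgE F g : dual_galg F @@ g = F g.
Proof.
rewrite dual_ofE; last first.
  move=> c x y; rewrite scaler_sumr -big_split; apply: eq_bigr => h _ /=.
  by rewrite !ffunE mulrDl; congr (_ + _); rewrite [RHS]mulrA.
rewrite (bigD1 g) //= ffunE eqxx mul1r big1 ?addr0 // => h hg.
by rewrite ffunE (negbTE hg) mul0r.
Qed.

(** The values of [dual_ev2] separate tensors and are bilinear in the two points, so points from a
    spanning set suffice. *)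
Lemma dual_galg2_ext (t t' : dual kG ⊗ dual kG) :
  (forall g g', dual_ev2 t (galg_elt k g) (galg_elt k g') =
                dual_ev2 t' (galg_elt k g) (galg_elt k g')) -> t = t'.
Proof.
have lin2 (s : dual kG ⊗ dual kG) :
    bilin (fun x y => dual_ev2 s x y : k^o).
  (* Bilinearity in the points is clear for a pure tensor and passes to sums. *)
  rewrite (tensorE s); elim/big_ind: _ => [|s1 s2 b1 b2|p _].
  - by apply: bilinI => *; rewrite !dual_ev20 ?addr0 ?scaler0.
  - apply: bilinI => *; rewrite !dual_ev2D.
    + by rewrite (bilinDl b1) (bilinDl b2) addrACA.
    + by rewrite (bilinZl b1) (bilinZl b2) scalerDr.
    + by rewrite (bilinDr b1) (bilinDr b2) addrACA.
    + by rewrite (bilinZr b1) (bilinZr b2) scalerDr.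
  - have b := dual_bilin p.1 p.2.
    apply: bilinI => *; rewrite !dual_ev2E.
    + by rewrite (bilinDl b).
    + by rewrite (bilinZl b).
    + by rewrite (bilinDr b).
    + by rewrite (bilinZr b).
move=> tt'; apply: dual_ev2_ext => x y; move: x.
apply: (@galg_lin_ext k G k^o); [exact: (lin2 t).1|exact: (lin2 t').1|move=> g].
move: y; apply: (@galg_lin_ext k G k^o) => //; first exact: (lin2 t).2.
exact: (lin2 t').2.
Qed.
End GroupAlgebraDual.

(** * Bialgebra homomorphisms as families of matrices indexed by the group *)

Section MatrixFamily.
Variables (k : fieldType) (G : finGroupType) (n : nat).
Variable tau : 'I_n -> 'I_n -> 'I_n -> k.
Local Notation A := (univ_alg tau).
Local Notation kG := (group_alg k G).
Local Notation "f @@ g" := (dual_ev f (galg_elt k g)) (at level 10).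

Definition hom_mx (theta : A -> dual kG) (g : G) : 'M[k]_n :=
  \matrix_(s, i) theta (univ_gen tau s i) @@ g.

Section OfHom.
Variable theta : bialg_hom A (dual kG).

(** The generators satisfy the defining relations, and the character obtained from [theta] by
    evaluating at [g] carries these over to its values. *)
Lemma hom_mx_compat g : univ_compat tau (hom_mx theta g : 'M[k^o]_n).
Proof.
move=> a i j.
have := congr1 (fun x => theta x @@ g) (univ_gen_compat tau a i j).
have lev := dual_evl_linear (galg_elt k g : kG).
rewrite !linear_sum !(linf_sum lev) => h.
transitivity (\sum_(u < n) theta (tau i j u *: (\matrix_(i, j) univ_gen tau i j) a u) @@ g).
  by apply: eq_bigr => u _; rewrite linearZ dual_evZl !mxE.
rewrite h; apply: eq_bigr => s _; rewrite linear_sum (linf_sum lev).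
by apply: eq_bigr => t _; rewrite linearZ dual_evZl rmorphM dual_galgM !mxE.
Qed.

Lemma hom_mx1 : hom_mx theta 1%g = 1%:M.
Proof.
apply/matrixP => i j; rewrite !mxE.
have := bialg_fun_counit theta (univ_gen tau i j).
(* The counit of the dual is evaluation at the unit of [kG], which is the group element [1]. *)
by rewrite [counit (univ_gen _ _ _)]univ_counit_gen.
Qed.

(** Evaluation at [g * g'] pairs the coproduct with [g] and [g']; on generators the coproduct is the
    matrix product formula. *)
Lemma hom_mxM g g' : hom_mx theta (g * g')%g = hom_mx theta g *m hom_mx theta g'.
Proof.
apply/matrixP => i j; rewrite !mxE -galg_eltM -dual_comulE.
have ltheta : linear theta by exact: lmorE.
rewrite -[dual_comul _]/(comul (theta (univ_gen tau i j))) bialg_fun_comul.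
rewrite [comul (univ_gen _ _ _)]univ_comul_gen.
rewrite (linf_sum (tmap_linear ltheta ltheta)) (linf_sum (dual_ev2_linear _ _)).
by apply: eq_bigr => s _; rewrite tmapE // dual_ev2E !mxE.
Qed.
End OfHom.

(** The generators determine an algebra map, and the group elements determine a linear form. *)
Lemma hom_mx_inj (theta theta' : bialg_hom A (dual kG)) :
  hom_mx theta =1 hom_mx theta' -> theta = theta'.
Proof.
move=> mxE'; apply: bialg_hom_ext; apply: univ_lrm_ext; try exact: lmorE.
- by split; [exact: rmorph1|exact: rmorphM].
- by split; [exact: rmorph1|exact: rmorphM].
move=> i j; apply: dual_galg_ext => g.
by have /matrixP/(_ i j) := mxE' g; rewrite !mxE.
Qed.

Section ToHom.
Variable M : G -> 'M[k]_n.
Hypotheses (cM : forall g, univ_compat tau (M g : 'M[k^o]_n)) (M1 : M 1%g = 1%:M)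
  (MM : forall g g', M (g * g')%g = M g *m M g').

(* An algebra map into the functions on G is a family over G of characters,
   so no commutative algebra structure on [dual kG] is needed. *)
Definition mx_hom_fun (x : A) : dual kG :=
  dual_galg (fun g => univ_lift (M g : 'M[k^o]_n) x).

Lemma mx_hom_gen i j g : mx_hom_fun (univ_gen tau i j) @@ g = M g i j.
Proof. by rewrite dual_galgE (univ_lift_gen (cM g)). Qed.

Lemma mx_hom_linear : linear mx_hom_fun.
Proof.
move=> c x y; apply: dual_galg_ext => g.
by rewrite dual_evDl dual_evZl !dual_galgE (univ_lift_linear (cM g)).
Qed.

Lemma mx_hom_mul : monoid_morphism mx_hom_fun.
Proof.
split=> [|x y]; apply: dual_galg_ext => g; rewrite !dual_galgE.
  by rewrite dual_galg1 (univ_lift_mul (cM g)).1.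
by rewrite dual_galgM !dual_galgE (univ_lift_mul (cM g)).2.
Qed.

HB.instance Definition _ :=
  GRing.isLinear.Build k A (dual kG) _ mx_hom_fun mx_hom_linear.
HB.instance Definition _ :=
  GRing.isMonoidMorphism.Build A (dual kG) mx_hom_fun mx_hom_mul.

(** Both sides are algebra maps in [x], so generators suffice; paired with two group elements, the
    identity there becomes [MM]. *)
Lemma mx_hom_comul x :
  comul (mx_hom_fun x) = tmap mx_hom_fun mx_hom_fun (comul x).
Proof.
have lt := tmap_linear mx_hom_linear mx_hom_linear.
move: x; apply: univ_lrm_ext.
- by apply: linear_comp; [exact: lmorE|exact: mx_hom_linear].
- by apply: linear_comp => //; exact: lmorE.
- by split=> [|x y]; rewrite ?rmorph1 ?rmorphM.
- split=> [|x y]; last by rewrite rmorphM tmapM.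
  rewrite rmorph1 tmapE ?mx_hom_mul.1 //; exact: mx_hom_linear.
move=> i j; apply: dual_galg2_ext => g g'.
rewrite [comul (mx_hom_fun _)]/(dual_comul _) dual_comulE galg_eltM mx_hom_gen MM mxE.
rewrite [comul (univ_gen _ _ _)]univ_comul_gen (linf_sum lt).
rewrite (linf_sum (dual_ev2_linear _ _)); apply: eq_bigr => s _.
rewrite tmapE; try exact: mx_hom_linear.
by rewrite dual_ev2E !mx_hom_gen.
Qed.

Lemma mx_hom_counit x : counit (mx_hom_fun x) = counit x.
Proof.
move: x; apply: (@univ_lrm_ext _ _ _ k^o).
- by apply: linear_comp; [exact: lmorE|exact: mx_hom_linear].
- exact: lmorE.
- by split=> [|x y]; rewrite ?rmorph1 ?rmorphM.
- by split=> [|x y]; rewrite ?rmorph1 ?rmorphM.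
move=> i j; rewrite [RHS]univ_counit_gen.
by rewrite -[LHS]/(mx_hom_fun (univ_gen tau i j) @@ 1%g) mx_hom_gen M1 mxE.
Qed.

Definition mx_hom : bialg_hom A (dual kG) :=
  @BialgHom k A (dual kG) mx_hom_fun mx_hom_comul mx_hom_counit.

Lemma mx_homK g : hom_mx mx_hom g = M g.
Proof. by apply/matrixP => i j; rewrite mxE mx_hom_gen. Qed.
End ToHom.
End MatrixFamily.

(** * Matrices and linear endomorphisms of the Leibniz algebra *)

Section MatrixEndo.
Variables (k : fieldType) (h : finDimLeibnizType k) (n : nat) (e : n.-tuple h).
Hypothesis he : basis_of fullv e.
Implicit Types (M N : 'M[k]_n) (f : h -> h).

(** Column [i] holds the coordinates of the image of the [i]-th basis vector, so that [*m] becomes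
    composition. *)
Definition mx_endo M (v : h) : h :=
  \sum_(i < n) coord e i v *: \sum_(s < n) M s i *: tnth e s.

Definition endo_mx f : 'M[k]_n := \matrix_(s, i) coord e s (f (tnth e i)).

Lemma coord_tnth i j : coord e j (tnth e i) = (i == j)%:R.
Proof. by rewrite (tnth_nth 0) coord_free // (basis_free he). Qed.

Lemma coord_sum_tnth (c : 'I_n -> k) s :
  coord e s (\sum_(t < n) c t *: tnth e t) = c s.
Proof.
under eq_bigr do rewrite (tnth_nth 0).
by rewrite coord_sum_free // (basis_free he).
Qed.

Lemma basis_expand v : v = \sum_(i < n) coord e i v *: tnth e i.
Proof.
rewrite {1}(coord_basis he (memvf v)).
by apply: eq_bigr => i _; rewrite (tnth_nth 0).
Qed.

Lemma basis_lin_ext (U : lmodType k) (f f' : h -> U) :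
  linear f -> linear f' -> (forall i, f (tnth e i) = f' (tnth e i)) -> f =1 f'.
Proof.
move=> lf lf' ff' v; rewrite (basis_expand v) !linf_sum //.
by apply: eq_bigr => i _; rewrite !linfZ // ff'.
Qed.

Lemma mx_endo_linear M : linear (mx_endo M).
Proof.
move=> c v w; rewrite scaler_sumr -big_split; apply: eq_bigr => i _ /=.
by rewrite linearP scalerDl scalerA.
Qed.

Lemma mx_endo_basis M i : mx_endo M (tnth e i) = \sum_(s < n) M s i *: tnth e s.
Proof.
rewrite /mx_endo (bigD1 i) //= coord_tnth eqxx scale1r [X in _ + X]big1 ?addr0 // => j ji.
by rewrite coord_tnth eq_sym (negbTE ji) scale0r.
Qed.

Lemma mx_endo1 : mx_endo 1%:M =1 id.
Proof.
apply: basis_lin_ext => [||i] //; first exact: mx_endo_linear.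
rewrite mx_endo_basis (bigD1 i) //= mxE eqxx scale1r big1 ?addr0 // => j ji.
by rewrite mxE (negbTE ji) scale0r.
Qed.

Lemma mx_endoM M N v : mx_endo (M *m N) v = mx_endo M (mx_endo N v).
Proof.
have lM := mx_endo_linear M; move: v; apply: basis_lin_ext => [||i].
- exact: mx_endo_linear.
- by apply: linear_comp => //; exact: mx_endo_linear.
rewrite !mx_endo_basis (linf_sum lM).
under [RHS]eq_bigr do rewrite (linfZ lM) mx_endo_basis scaler_sumr.
rewrite exchange_big; apply: eq_bigr => s _ /=; rewrite mxE scaler_suml.
by apply: eq_bigr => t _; rewrite scalerA mulrC.
Qed.

Lemma endo_mxK f : linear f -> mx_endo (endo_mx f) =1 f.
Proof.
move=> lf; apply: basis_lin_ext => // [|i]; first exact: mx_endo_linear.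
rewrite mx_endo_basis [RHS]basis_expand.
by apply: eq_bigr => s _; rewrite mxE.
Qed.

Lemma mx_endo_inj M N : mx_endo M =1 mx_endo N -> M = N.
Proof.
move=> MN; apply/matrixP => s i.
by have := congr1 (coord e s) (MN (tnth e i)); rewrite !mx_endo_basis !coord_sum_tnth.
Qed.

Lemma mx_endo_bracket_coord M a i j :
  coord e a (mx_endo M (lbracket (tnth e i) (tnth e j))) =
  \sum_(u < n) struct_const e i j u * M a u.
Proof.
rewrite {1}/mx_endo; under eq_bigr do rewrite scaler_sumr.
rewrite exchange_big /=; under eq_bigr do (under eq_bigr do rewrite scalerA).
by under eq_bigr do rewrite -scaler_suml; rewrite coord_sum_tnth.
Qed.

Lemma bracket_mx_endo_coord M a i j :
  coord e a (lbracket (mx_endo M (tnth e i)) (mx_endo M (tnth e j))) =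
  \sum_(s < n) \sum_(t < n) struct_const e s t a * (M s i * M t j).
Proof.
have lb := @lbracket_bilin k h.
rewrite !mx_endo_basis (bilin_suml lb) linear_sum; apply: eq_bigr => s _.
rewrite (bilin_sumr lb) linear_sum; apply: eq_bigr => t _.
rewrite (bilinZl lb) (bilinZr lb) !linearZ /= -/(struct_const e s t a).
by rewrite [LHS]mulrA mulrC.
Qed.

(* The relations of the universal algebra at [M] are the coordinates of the
   identity [M [e_i, e_j] = [M e_i, M e_j]]. *)
Lemma mx_endo_compatP M :
  {morph mx_endo M : x y / lbracket x y} <->
  univ_compat (struct_const e) (M : 'M[k^o]_n).
Proof.
have lb := @lbracket_bilin k h; have lM := mx_endo_linear M.
split=> [mM a i j|cM x y].
  by have := congr1 (coord e a) (mM (tnth e i) (tnth e j));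
    rewrite mx_endo_bracket_coord bracket_mx_endo_coord.
move: x; apply: basis_lin_ext => [||i].
- by apply: linear_comp => //; exact: lb.1.
- by apply: (@linear_comp _ _ _ _ (fun x => lbracket x _)) => //; exact: lb.1.
move: y; apply: basis_lin_ext => [||j].
- by apply: linear_comp => //; exact: lb.2.
- by apply: linear_comp => //; exact: lb.2.
rewrite [LHS]basis_expand [RHS]basis_expand; apply: eq_bigr => a _.
by rewrite mx_endo_bracket_coord bracket_mx_endo_coord [X in X *: _](cM a i j).
Qed.

(** * Actions by automorphisms as families of matrices *)

Section MatrixAut.
Variable G : finGroupType.

Section FromMatrix.
Variable M : G -> 'M[k]_n.
Hypotheses (cM : forall g, univ_compat (struct_const e) (M g : 'M[k^o]_n))
  (M1 : M 1%g = 1%:M) (MM : forall g g', M (g * g')%g = M g *m M g').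

Lemma mx_endo_bij g : bijective (mx_endo (M g)).
Proof.
by exists (mx_endo (M g^-1%g)) => v; rewrite -mx_endoM -MM ?mulVg ?mulgV M1 mx_endo1.
Qed.

Definition mx_aut g : lbz_aut h :=
  LbzAut (mx_endo_linear (M g)) (mx_endo_bij g) ((mx_endo_compatP (M g)).2 (cM g)).

Lemma mx_autM : {morph mx_aut : g g' / (g * g')%g}.
Proof. by move=> g g'; apply: lbz_aut_ext => v /=; rewrite MM mx_endoM. Qed.

HB.instance Definition _ := isMultiplicative.Build G (lbz_aut h) mx_aut mx_autM.

Definition mx_action : {multiplicative G -> lbz_aut h} := mx_aut.
End FromMatrix.

Variable f : {multiplicative G -> lbz_aut h}.

Lemma action_mx_compat g : univ_compat (struct_const e) (endo_mx (f g) : 'M[k^o]_n).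
Proof.
have fK := endo_mxK (lbz_aut_linear (f g)).
by apply/mx_endo_compatP => x y; rewrite !fK lbz_aut_bracket.
Qed.

Lemma action_mx1 : endo_mx (f 1%g) = 1%:M.
Proof.
(* A multiplicative map is only given to preserve products; cancellation in the automorphism group
   yields the unit. *)
have f1 : f 1%g = 1%g by apply: (mulgI (f 1%g)); rewrite -gmulfM !mulg1.
apply: mx_endo_inj => v; rewrite endo_mxK; last exact: lbz_aut_linear.
by rewrite f1 mx_endo1.
Qed.

Lemma action_mxM g g' : endo_mx (f (g * g')%g) = endo_mx (f g) *m endo_mx (f g').
Proof.
apply: mx_endo_inj => v; rewrite mx_endoM !endo_mxK; try exact: lbz_aut_linear.
by rewrite gmulfM.
Qed.
End MatrixAut.
End MatrixEndo.

Theorem proposition3p6 (k : fieldType) (G : finGroupType)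
    (h : finDimLeibnizType k) (n : nat) (e : n.-tuple h)
    (he : basis_of fullv e) :
  exists phi : bialg_hom (univ_alg (struct_const e)) (dual (group_alg k G)) ->
               {multiplicative G -> lbz_aut h},
    bijective phi /\
    forall (theta : bialg_hom (univ_alg (struct_const e)) (dual (group_alg k G)))
           (g : G) (i : 'I_n),
      phi theta g (tnth e i) =
      \sum_(s < n) dual_ev (theta (univ_gen (struct_const e) s i)) (galg_elt k g)
        *: tnth e s.
Proof.
exists (fun theta =>
  mx_action he (hom_mx_compat theta) (hom_mx1 theta) (hom_mxM theta)).
split; last first.
  move=> theta g i; rewrite [LHS](mx_endo_basis he).
  by apply: eq_bigr => s _; rewrite mxE.
(* The inverse takes the matrices of an action and reads them as characters of the universal
   algebra. *)
exists (fun f => mx_hom (action_mx_compat he f) (action_mx1 he f) (action_mxM he f)).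
  move=> theta; apply: hom_mx_inj => g; rewrite mx_homK /=.
  by apply: (mx_endo_inj he) => v; rewrite (endo_mxK he) //; exact: mx_endo_linear.
move=> f; apply: multiplicative_ext => g; apply: lbz_aut_ext => v.
(* The matrix also occurs in the proofs bundled in [mx_action], so it is replaced only in the
   underlying function. *)
rewrite [LHS](congr1 (fun M => mx_endo e M v) (mx_homK _ _ _ g)) (endo_mxK he) //.
exact: lbz_aut_linear.
Qed.
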